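(* For ${\rm APP}=\{{\rm APP}_d\}_{d\in\mathbb N}$ in the average case setting with the absolute error criterion, ${\rm APP}$ is ALG-WT for $\Lambda^{\rm all}$ if and only if it is ALG-WT for $\Lambda^{\rm std}$.
   Context: Setting (average case approximation). For each $d\in\mathbb N$: $D_d\subset\mathbb R^d$ is a Borel set of positive Lebesgue measure, $\rho_d$ is a probability density on $D_d$, and $G_d=L_2(D_d,\rho_d(x)\,dx)$. $F_d$ is a separable Banach space of real-valued functions on $D_d$, continuously embedded in $G_d$, such that every point evaluation $f\mapsto f(x)$, $x\in D_d$, is a continuous linear functional on $F_d$; $F_d$ carries a zero-mean Gaussian measure $\mu_d$. ${\rm APP}_d:F_d\to G_d$, ${\rm APP}_d f=f$. $\Lambda^{\rm all}$ is the class of all continuous linear functionals on $F_d$, $\Lambda^{\rm std}$ the class of point evaluations. For $\Lambda\in\{\Lambda^{\rm all},\Lambda^{\rm std}\}$, an algorithm is $A_{n,d}f=\phi_{n,d}(L_1(f),\dots,L_n(f))$ with $L_i\in\Lambda$ and $\phi_{n,d}:\mathbb R^n\to G_d$ measurable; its average case error is $e^{\rm avg}(A_{n,d})=\big(\int_{F_d}\|f-A_{n,d}f\|_{G_d}^2\,\mu_d(df)\big)^{1/2}$, and $e^{\rm avg}(n,d;\Lambda)$ is the infimum of $e^{\rm avg}(A_{n,d})$ over all such algorithms using $n$ functionals from $\Lambda$ (for $n=0$, $A_{0,d}=0$). Absolute-error information complexity: $n^{\rm ABS}(\varepsilon,d;\Lambda)=\min\{n\ge0:\ e^{\rm avg}(n,d;\Lambda)\le\varepsilon\}$.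 ALG-WT for $\Lambda$: $\lim_{\varepsilon^{-1}+d\to\infty}\frac{\ln n^{\rm ABS}(\varepsilon,d;\Lambda)}{\varepsilon^{-1}+d}=0$, where the limit means: for every $\eta>0$ there is $M$ such that the quotient is $<\eta$ for all $d\in\mathbb N$, $\varepsilon\in(0,1)$ with $\varepsilon^{-1}+d>M$ (with the convention $\ln 0:=-\infty$ or $0$). *)

(* Defs.v *)
From HB Require Import structures.
From mathcomp Require Import all_boot all_order all_algebra.
From mathcomp Require Import all_classical all_reals all_analysis.

Set Implicit Arguments.
Unset Strict Implicit.
Unset Printing Implicit Defensive.
Import Order.TTheory GRing.Theory Num.Theory.
Import numFieldNormedType.Exports.
Local Open Scope classical_set_scope.
Local Open Scope ring_scope.

Section AvgApp.
Variable R : realType.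

(* Iterated Lebesgue integral over R^n = n.-tuple R (with the product sigma
   algebra of n.-tuple R); by Tonelli it is the integral w.r.t. the
   n-dimensional Lebesgue measure for nonnegative measurable integrands. *)
Fixpoint itint (n : nat) : (n.-tuple R -> \bar R) -> \bar R :=
  match n return (n.-tuple R -> \bar R) -> \bar R with
  | 0 => fun g => g [tuple]
  | m.+1 => fun g =>
      (\int[@lebesgue_measure R]_x itint (fun t : m.-tuple R => g (cons_tuple x t)))%E
  end.

Definition lebesgue_nd (n : nat) (A : set (n.-tuple R)) : \bar R :=
  itint (fun x => (\1_A x : R)%:E).

(* Data of the problem APP = {APP_d}. The index d : nat stands for the
   dimension d.+1 (so that dimensions range over N = {1,2,...}). *)
Record app_data := AppData {
  Fsp : nat -> completeNormedModType R;
  Dom : forall d, set (d.+1.-tuple R);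
  rho : forall d, d.+1.-tuple R -> R;
  ev  : forall d, Fsp d -> d.+1.-tuple R -> R; (* f |-> (x |-> f(x)) *)
  mu  : forall d, probability (g_sigma_algebraType (@open (Fsp d))) R
}.

End AvgApp.
Arguments Fsp {R} _ _.
Arguments Dom {R} _ _ _.
Arguments rho {R} _ _ _.
Arguments ev {R} _ _ _ _.
Arguments mu {R} _ _.

Section AvgApp2.
Variable R : realType.
Variable P : app_data R.

Definition lin_functional (V : lmodType R) (L : V -> R) :=
  forall (a : R) (f g : V), L (a *: f + g) = a * L f + L g.

(* squared norm in G_d = L_2(D_d, rho_d(x) dx) *)
Definition gnorm2 (d : nat) (h : d.+1.-tuple R -> R) : \bar R :=
  itint (fun x => (\1_(Dom P d) x * rho P d x * h x ^+ 2)%:E).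

Definition zero_mean_gaussian (d : nat) :=
  forall L : Fsp P d -> R, lin_functional L -> continuous L ->
    (exists2 s : R, 0 < s & forall B : set R, measurable B ->
        mu P d (L @^-1` B) = normal_prob 0 s B)
    \/ (forall B : set R, measurable B -> mu P d (L @^-1` B) = \d_(0 : R) B).

Definition app_setting : Prop :=
  forall d : nat,
  [/\
      measurable (Dom P d) /\ (0 < lebesgue_nd (Dom P d))%E,
      [/\ measurable_fun (Dom P d) (rho P d),
          (forall x, Dom P d x -> 0 <= rho P d x) &
          itint (fun x => (\1_(Dom P d) x * rho P d x)%:E) = 1%E],
      (exists2 S : set (Fsp P d), (countable S) & (closure S = setT)) /\
      (forall a (f g : Fsp P d) x, Dom P d x ->
         ev P d (a *: f + g) x = a * ev P d f x + ev P d g x),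
      (* F_d continuously embedded in G_d *)
      [/\ (forall f, measurable_fun (Dom P d) (ev P d f)),
          (forall f, (gnorm2 (ev P d f) < +oo)%E),
          (exists C : R, forall f : Fsp P d,
             (gnorm2 (ev P d f) <= EFin ((C * `|f|) ^+ 2)%R)%E) &
          (forall f, gnorm2 (ev P d f) = 0%E -> f = 0)] /\
      (forall x, Dom P d x -> continuous (fun f : Fsp P d => ev P d f x)) &
      zero_mean_gaussian d].

Inductive info_class := Lall | Lstd.

Definition in_class (c : info_class) (d : nat) (L : Fsp P d -> R) : Prop :=
  match c with
  | Lall => lin_functional L /\ continuous L
  | Lstd => exists2 x, Dom P d x & L = (fun f => ev P d f x)
  end.

Definition esqrt (x : \bar R) : \bar R :=
  match x with
  | EFin r => (Num.sqrt r)%:E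
  | +oo%E => +oo%E
  | -oo%E => 0%E
  end.

(* A_{n,d} f = phi(L_1 f, ..., L_n f); phi : R^n -> G_d measurable, given by a
   jointly measurable kernel (y, x) |-> phi y x *)
Definition eavg (d n : nat) (L : 'I_n -> Fsp P d -> R)
    (phi : n.-tuple R -> d.+1.-tuple R -> R) : \bar R :=
  esqrt (\int[mu P d]_(f in setT)
           gnorm2 (fun x => (ev P d f x - phi [tuple L i f | i < n] x)%R))%E.

Definition admissible (c : info_class) (d n : nat) (L : 'I_n -> Fsp P d -> R)
    (phi : n.-tuple R -> d.+1.-tuple R -> R) : Prop :=
  [/\ forall i, in_class c (L i),
      measurable_fun setT (fun p : n.-tuple R * d.+1.-tuple R => phi p.1 p.2) &
      (n = 0%N -> forall y x, phi y x = 0)  (* A_{0,d} = 0 *)].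

Definition eavg_n (c : info_class) (n d : nat) : \bar R :=
  ereal_inf [set e | exists (L : 'I_n -> Fsp P d -> R)
                              (phi : n.-tuple R -> d.+1.-tuple R -> R),
                   admissible c L phi /\ e = eavg L phi].

Definition nABS_pred (c : info_class) (eps : R) (d : nat) : pred nat :=
  fun n => `[< (eavg_n c n d <= eps%:E)%E >].

(* n^ABS(eps, d; Lambda) = min {n : e^avg(n,d;Lambda) <= eps}; None if the
   set is empty (n^ABS = +oo) *)
Definition nABS (c : info_class) (eps : R) (d : nat) : option nat :=
  match pselect (exists n, nABS_pred c eps d n) with
  | left h => Some (ex_minn h)
  | right _ => None
  end.

(* ALG-WT, with ln 0 := 0 (= mathcomp's ln 0) ; dimension is d.+1 *)
Definition ALG_WT (c : info_class) : Prop :=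
  forall eta : R, 0 < eta -> exists M : R, forall (d : nat) (eps : R),
    0 < eps < 1 -> M < eps^-1 + (d.+1)%:R ->
    match nABS c eps d with
    | Some n => is_true (ln (n%:R : R) / (eps^-1 + (d.+1)%:R) < eta)
    | None => False
    end.

End AvgApp2.

(* Main.v *)
From HB Require Import structures.
Require Import Defs.
From mathcomp Require Import all_boot all_order all_algebra.
From mathcomp Require Import all_classical all_reals all_analysis.
From mathcomp Require Import finmap measurable_realfun ring lra.

(** Point evaluations are continuous functionals, so only the passage from
    general to standard information needs an argument.

    An algorithm using [n] functionals [L_i] of a Gaussian [f] can be replaced by
    the linear regression of [f(x)] on the [L_i f], pointwise in [x]: the residual
    [Z] is uncorrelated with the data, so by Cramer-Wold [(Z, L f)] and
    [(-Z, L f)] have the same law, whence [E (Z + psi(L f))^2 >= E Z^2] for all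
    [psi]. So [f] is approximated, with error [e], by random elements of a fixed
    space of functions of dimension at most [n].

    Let [e_1, ..., e_k] ([k <= n]) be an orthonormal basis of the square
    integrable part of that space, and [g_f] the residual of the orthogonal
    projection of [f].  Sampling with density [w = (sum_j e_j^2) / k], the empirical
    Gram matrix [sum_l e_i(x_l) e_j(x_l) / (N w(x_l))] has mean the identity and
    the vectors [sum_l g_f(x_l) e_j(x_l) / (N w(x_l))] have mean zero.  Choosing
    the points one after the other, each not worse than average for the
    accumulated squared deviation, controls both deterministically with
    [N = 4 (k+1)^4] points; the weighted least squares approximation at these
    points then has mean square error at most [4 e^2].  Since the number of points is
    polynomial in [n], the logarithm of the complexity changes by at most a
    factor 4 plus a constant, which ALG-WT does not see. *)

Set Implicit Arguments.
Unset Strict Implicit.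
Unset Printing Implicit Defensive.
Import Order.TTheory GRing.Theory Num.Theory.
Import numFieldNormedType.Exports.
Local Open Scope classical_set_scope.
Local Open Scope ring_scope.

(** * Square integrable functions and greedy sampling *)

(** Origin of the constants: each of the [k^2] Gram deviations has mean square at most [(k+1)^2],
    and the residual terms, rescaled by [E^(-1/2)], add at most [k] in total, so everything stays
    below [K = (k+1)^4]. After [N] greedy steps the accumulated square is at most [N K]; the
    averages then deviate by at most [K / N] in square, and [N = 4 K] makes this [1/4], small enough
    to invert the Gram matrix at the price of a factor 2 in norm.

    Two obstacles shape the rest. The Gaussian assumption describes only the images of the measure
    under single functionals, whereas an algorithm may process its data by any measurable map;
    equality of joint laws therefore has to be derived from linear marginals, by growing cosines
    into indicators of boxes through products and pointwise limits. And the regression coefficients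
    are merely measurable functions of [x], so their span may contain functions that are not square
    integrable; the orthonormal system is obtained by maximality instead of by orthogonalising
    generators. *)

Lemma sqrD_le2 (R : realDomainType) (a b : R) : (a + b) ^+ 2 <= 2 * a ^+ 2 + 2 * b ^+ 2.
Proof.
rewrite -subr_ge0 (_ : _ - _ = (a - b) ^+ 2) ?sqr_ge0//.
by ring.
Qed.

Section SquareIntegrable.
Context d (T : measurableType d) (R : realType).
Variable m : {measure set T -> \bar R}.
Implicit Types u v : T -> R.

Definition sqint u : \bar R := (\int[m]_x ((u x) ^+ 2)%:E)%E.

Definition L2 u := measurable_fun setT u /\ (sqint u < +oo)%E.

Definition ip u v : R := \int[m]_x (u x * v x).

Lemma sqint_ge0 u : (0 <= sqint u)%E.
Proof. by apply: integral_ge0 => x _; rewrite lee_fin sqr_ge0. Qed.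

Lemma measurable_sqr u : measurable_fun setT u ->
  measurable_fun setT (fun x => ((u x) ^+ 2)%:E).
Proof. by move=> mu; apply/measurable_EFinP; exact: measurable_funX. Qed.

Lemma L2_sqr_integrable u : L2 u -> m.-integrable setT (fun x => ((u x) ^+ 2)%:E).
Proof.
move=> [mu hu]; apply/integrableP; split; first exact: measurable_sqr.
by under eq_integral do rewrite gee0_abs ?lee_fin ?sqr_ge0//.
Qed.

Lemma L2_mul_integrable u v : L2 u -> L2 v ->
  m.-integrable setT (fun x => (u x * v x)%:E).
Proof.
move=> Lu Lv.
have h : m.-integrable setT (fun x => ((u x) ^+ 2 + (v x) ^+ 2)%:E).
  under eq_fun do rewrite EFinD.
  by apply: integrableD => //; exact: L2_sqr_integrable.
apply: le_integrable h => //.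
  by apply/measurable_EFinP; apply: measurable_funM; [case: Lu|case: Lv].
move=> x _; rewrite /= lee_fin normrM.
have h1 : 0 <= (u x) ^+ 2 + (v x) ^+ 2 by rewrite addr_ge0 ?sqr_ge0.
rewrite (ger0_norm h1) -(real_normK (num_real (u x))) -(real_normK (num_real (v x))).
nra.
Qed.

Lemma L2D u v : L2 u -> L2 v -> L2 (fun x => u x + v x).
Proof.
move=> Lu Lv; split.
  by apply: measurable_funD; [case: Lu|case: Lv].
have : m.-integrable setT (fun x => (2 * (u x) ^+ 2 + 2 * (v x) ^+ 2)%:E).
  under eq_fun do rewrite EFinD !EFinM.
  by apply: integrableD => //; apply: integrableZl => //; exact: L2_sqr_integrable.
move=> /(integrable_lty measurableT); apply: le_lt_trans; rewrite /sqint.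
have mu : measurable_fun setT u by case: Lu.
have mv : measurable_fun setT v by case: Lv.
apply: ge0_le_integral => //=.
- by move=> x _; rewrite lee_fin sqr_ge0.
- by apply: measurable_sqr; exact: measurable_funD.
- by apply/measurable_EFinP; apply: measurable_funD; apply: measurable_funM => //;
    exact: measurable_funX.
- move=> x _; rewrite lee_fin; exact: sqrD_le2.
Qed.

Lemma sqintZ (a : R) u : measurable_fun setT u ->
  sqint (fun x => a * u x) = ((a ^+ 2)%:E * sqint u)%E.
Proof.
move=> mu; rewrite /sqint; under eq_integral do rewrite exprMn EFinM.
rewrite ge0_integralZl ?lee_fin ?sqr_ge0//; first exact: measurable_sqr.
by move=> x _; rewrite lee_fin sqr_ge0.
Qed.

Lemma L2Z (a : R) u : L2 u -> L2 (fun x => a * u x).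
Proof.
move=> Lu; have mu : measurable_fun setT u by case: Lu.
split; first exact: measurable_funM.
rewrite sqintZ// lte_mul_pinfty ?lee_fin ?sqr_ge0//.
by case: Lu.
Qed.

Lemma L2_0 : L2 (fun=> 0).
Proof.
split; first exact: measurable_cst.
by rewrite /sqint expr0n /= integral0.
Qed.

Lemma L2_sum (I : Type) (s : seq I) (u : I -> T -> R) :
  (forall i, L2 (u i)) -> L2 (fun x => \sum_(i <- s) u i x).
Proof.
move=> h; elim: s => [|i s ih].
  by under eq_fun do rewrite big_nil; exact: L2_0.
by under eq_fun do rewrite big_cons; exact: L2D.
Qed.

Lemma L2B u v : L2 u -> L2 v -> L2 (fun x => u x - v x).
Proof.
move=> Lu Lv; have := L2D Lu (L2Z (-1) Lv).
by under eq_fun do rewrite mulN1r.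
Qed.

Lemma ipC u v : ip u v = ip v u.
Proof. by rewrite /ip; under eq_Rintegral do rewrite mulrC. Qed.

Lemma ipDl u v w : L2 u -> L2 v -> L2 w ->
  ip (fun x => u x + v x) w = ip u w + ip v w.
Proof.
move=> Lu Lv Lw; rewrite /ip; under eq_Rintegral do rewrite mulrDl.
by rewrite RintegralD//; exact: L2_mul_integrable.
Qed.

Lemma ipZl a u w : L2 u -> L2 w -> ip (fun x => a * u x) w = a * ip u w.
Proof.
move=> Lu Lw; rewrite /ip; under eq_Rintegral do rewrite -mulrA.
by rewrite RintegralZl//; exact: L2_mul_integrable.
Qed.

Lemma ipBl u v w : L2 u -> L2 v -> L2 w ->
  ip (fun x => u x - v x) w = ip u w - ip v w.
Proof.
move=> Lu Lv Lw; rewrite /ip; under eq_Rintegral do rewrite mulrBl.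
by rewrite RintegralB//; exact: L2_mul_integrable.
Qed.

Lemma ip_suml (I : Type) (s : seq I) (u : I -> T -> R) w :
  (forall i, L2 (u i)) -> L2 w ->
  ip (fun x => \sum_(i <- s) u i x) w = \sum_(i <- s) ip (u i) w.
Proof.
move=> Lu Lw; elim: s => [|i s ih].
  rewrite big_nil /ip; under eq_Rintegral do rewrite big_nil mul0r.
  by rewrite /Rintegral integral0.
rewrite big_cons -ih -ipDl//; last exact: L2_sum.
by congr ip; apply/funext => x; rewrite big_cons.
Qed.

Lemma ipDr u v w : L2 u -> L2 v -> L2 w ->
  ip w (fun x => u x + v x) = ip w u + ip w v.
Proof. by move=> *; rewrite ipC ipDl// !(ipC w). Qed.

Lemma ipZr a u w : L2 u -> L2 w -> ip w (fun x => a * u x) = a * ip w u.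
Proof. by move=> *; rewrite ipC ipZl// !(ipC w). Qed.

Lemma ipBr u v w : L2 u -> L2 v -> L2 w ->
  ip w (fun x => u x - v x) = ip w u - ip w v.
Proof. by move=> *; rewrite ipC ipBl// !(ipC w). Qed.

Lemma ip_sumr (I : Type) (s : seq I) (u : I -> T -> R) w :
  (forall i, L2 (u i)) -> L2 w ->
  ip w (fun x => \sum_(i <- s) u i x) = \sum_(i <- s) ip w (u i).
Proof. by move=> *; rewrite ipC ip_suml//; apply: eq_bigr => i _; rewrite ipC. Qed.

Lemma sqintE u : L2 u -> sqint u = (ip u u)%:E.
Proof.
move=> Lu; rewrite /ip /Rintegral fineK; last first.
  by apply: integrable_fin_num => //; exact: L2_mul_integrable.
by apply: eq_integral => x _; rewrite expr2.
Qed.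

Lemma ip_ge0 u : 0 <= ip u u.
Proof. by apply: Rintegral_ge0 => x _; rewrite -expr2 sqr_ge0. Qed.

Lemma sqintD_le u v : measurable_fun setT u -> measurable_fun setT v ->
  (sqint (fun x => u x + v x)%R <= 2%:E * sqint u + 2%:E * sqint v)%E.
Proof.
move=> mu mv; rewrite /sqint -!ge0_integralZl//; try exact: measurable_sqr;
  try (by move=> x _; rewrite lee_fin sqr_ge0).
rewrite -ge0_integralD//.
- apply: ge0_le_integral => //.
  + by move=> x _; rewrite lee_fin sqr_ge0.
  + by apply: measurable_sqr; exact: measurable_funD.
  + apply: emeasurable_funD; apply: measurable_funeM; exact: measurable_sqr.
  + move=> x _; rewrite -!EFinM -EFinD lee_fin; exact: sqrD_le2.
- by move=> x _; rewrite -EFinM lee_fin mulr_ge0 ?sqr_ge0.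
- by apply: measurable_funeM; exact: measurable_sqr.
- by move=> x _; rewrite -EFinM lee_fin mulr_ge0 ?sqr_ge0.
- by apply: measurable_funeM; exact: measurable_sqr.
Qed.

(** When [u] has norm zero, the squared norm of [t u + w] is affine in [t]; being nonnegative for
    all [t], it is constant. This replaces null-set arguments for functions of norm zero. *)
Lemma ip_eq0_ae u w : L2 u -> L2 w -> ip u u = 0 -> ip u w = 0.
Proof.
move=> Lu Lw u0.
have hz : forall t : R, 0 <= 2 * t * ip u w + ip w w.
  move=> t; have := ip_ge0 (fun x => t * u x + w x).
  have Ltu := L2Z t Lu; have Lt := L2D Ltu Lw.
  by rewrite ipDl// !ipDr// !ipZl// !ipZr// u0 (ipC w u); lra.
apply/eqP/negPn/negP => n0.
(* This [t] would make the affine function equal to [-1]. *)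
have := hz (- (ip w w + 1) / (2 * ip u w)).
have -> : 2 * (- (ip w w + 1) / (2 * ip u w)) * ip u w = - (ip w w + 1).
  by field.
lra.
Qed.

End SquareIntegrable.

Section AveragePoint.
Context d (T : measurableType d) (R : realType) (Q : probability T R).
Local Open Scope ereal_scope.

(** If [h] exceeded [K] on all of a set of full measure, its mean would be at least [K]. Restricting
    to [D] places the chosen point in a prescribed set. *)
Lemma exists_le_average (D : set T) (h : T -> \bar R) (K : \bar R) :
  measurable D -> Q D = 1 -> measurable_fun setT h -> (forall x, 0 <= h x) ->
  \int[Q]_x h x < K -> exists2 x, D x & h x <= K.
Proof.
move=> mD QD mh h0 hK.
have [//|H] := pselect (exists2 x, D x & h x <= K).
suff : K <= \int[Q]_x h x by rewrite leNgt hK.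
have -> : K = \int[Q]_(x in D) (cst K) x by rewrite integral_cst// [X in _ * X]QD mule1.
apply: (@le_trans _ _ (\int[Q]_(x in D) h x)).
  apply: ge0_le_integral => //.
  - move=> x Dx /=; apply: le_trans (ltW hK).
    exact: integral_ge0.
  - exact: measurable_funTS.
  - move=> x Dx /=; rewrite leNgt; apply/negP => /ltW hx.
    by apply: H; exists x.
exact: ge0_subset_integral.
Qed.

End AveragePoint.

Lemma integral_le_cst d (T : measurableType d) (R : realType) (Q : probability T R)
    (h : T -> \bar R) (c : R) :
  measurable_fun setT h -> (forall x, 0 <= h x)%E -> (forall x, h x <= c%:E)%E ->
  (\int[Q]_x h x <= c%:E)%E.
Proof.
move=> mh h0 hc.
apply: (@le_trans _ _ (\int[Q]_x (cst c%:E) x)%E).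
  exact: ge0_le_integral.
by rewrite integral_cst// [X in (_ * X)%E]probability_setT mule1.
Qed.

(** * Choosing sample points one by one *)

Section Greedy.
Context dF (F : measurableType dF) d (T : measurableType d) (R : realType).
Variables (mu : probability F R) (Q : probability T R).

(** The cross term [2 c u] has mean zero. In the greedy step [c] is the deviation accumulated so far
    and [u] the contribution of a new random point, so this is additivity of variances. *)
Lemma sqint_shift_le (c : R) (u : T -> R) :
  Q.-integrable setT (EFin \o u) -> \int[Q]_x u x = 0 ->
  (sqint Q (fun x => c + u x)%R <= (c ^+ 2)%:E + sqint Q u)%E.
Proof.
move=> iu u0.
have mu_ : measurable_fun setT u by apply/measurable_EFinP; case/integrableP: iu.
have := leey (sqint Q u); rewrite le_eqVlt => /predU1P[->|hu]; first by rewrite leey.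
have Lu : L2 Q u by [].
have Lc : L2 Q (fun=> c).
  split; first exact: measurable_cst.
  by rewrite /sqint integral_cst// [X in (_ * X)%E]probability_setT mule1 ltry.
rewrite !sqintE//; last exact: L2D.
have Lcu := L2D Lc Lu.
rewrite -EFinD lee_fin ipDl// !ipDr// (ipC _ u).
have -> : ip Q (fun=> c) u = 0.
  by rewrite /ip RintegralZl// u0 mulr0.
have -> : ip Q (fun=> c) (fun=> c) = c ^+ 2.
  by rewrite /ip Rintegral_cst// [X in fine X]probability_setT mulr1 expr2.
by rewrite addr0 add0r.
Qed.

Lemma measurable_sec1 (xi : F -> T -> R) x :
  measurable_fun setT (fun p : F * T => xi p.1 p.2) ->
  measurable_fun setT (fun f => xi f x).
Proof.
move=> mxi.
rewrite (_ : (fun f => xi f x) = (fun p => xi p.1 p.2) \o (fun f => (f, x)))//.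
by apply: measurableT_comp => //; exact: pair2_measurable.
Qed.

Lemma measurable_sec2 (xi : F -> T -> R) f :
  measurable_fun setT (fun p : F * T => xi p.1 p.2) ->
  measurable_fun setT (xi f).
Proof.
move=> mxi.
rewrite (_ : xi f = (fun p => xi p.1 p.2) \o (fun x => (f, x)))//.
by apply: measurableT_comp => //; exact: pair1_measurable.
Qed.

(** Averaged over the next point, the total squared deviation grows by less than [K], because the
    increments have mean zero; some point of [D] is no worse than [K]. All indices [i] share the
    same points, hence the sum over [I] is controlled as one quantity. *)
Lemma greedy_points (I : finType) (xi : I -> F -> T -> R) (D : set T) (K : R) :
  (forall i, measurable_fun setT (fun p : F * T => xi i p.1 p.2)) ->
  (forall i f, Q.-integrable setT (EFin \o xi i f)) ->
  (forall i f, \int[Q]_x xi i f x = 0) ->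
  (\sum_i \int[mu]_f sqint Q (xi i f) < K%:E)%E ->
  measurable D -> Q D = 1%E ->
  forall N, exists xs : nat -> T, (forall k, D (xs k)) /\
    (\sum_i sqint mu (fun f => \sum_(k < N) xi i f (xs k))%R <= (N%:R * K)%:E)%E.
Proof.
move=> mxi ixi xi0 hK mD QD; elim=> [|N [xs [Dxs hxs]]].
  have /set0P[x Dx] : D != set0.
    by apply/eqP => D0; move: QD; rewrite D0 measure0 => /eqP; rewrite eq_sym onee_eq0.
  exists (fun=> x); split => //.
  rewrite mul0r big1// => i _; rewrite /sqint.
  by under eq_integral do rewrite big_ord0 expr0n; rewrite integral0.
pose S i f := \sum_(k < N) xi i f (xs k).
have mS i : measurable_fun setT (S i).
  by apply: measurable_sum => k; exact: measurable_sec1.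
pose h x := (\sum_i sqint mu (fun f => (S i f + xi i f x)%R))%E.
have mSx i : measurable_fun setT (EFin \o (fun p : F * T => (S i p.1 + xi i p.1 p.2) ^+ 2)).
  apply/measurable_EFinP; apply: measurable_funX; apply: measurable_funD => //.
  exact: measurableT_comp.
have mh : measurable_fun setT h.
  apply: emeasurable_sum => i.
  apply: (measurable_fun_fubini_tonelli_G (m1 := mu) _ (mSx i)) => p.
  by rewrite lee_fin sqr_ge0.
have h0 x : (0 <= h x)%E by apply: sume_ge0 => i _; exact: sqint_ge0.
have msq i : measurable_fun setT (fun f => sqint Q (xi i f)).
  apply: (measurable_fun_fubini_tonelli_F (m2 := Q) (EFin \o (fun p => (xi i p.1 p.2) ^+ 2))).
    by apply: measurable_sqr.
  by move=> p; rewrite lee_fin sqr_ge0.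
(* Tonelli exchanges the new point with [f]; the variance bound is then applied for each fixed
   [f]. *)
have hh : (\int[Q]_x h x < (N.+1%:R * K)%:E)%E.
  rewrite /h ge0_integral_sum//; last 2 first.
  - move=> i; apply: (measurable_fun_fubini_tonelli_G (m1 := mu) _ (mSx i)) => p.
    by rewrite lee_fin sqr_ge0.
  - by move=> i x _; exact: sqint_ge0.
  apply: (@le_lt_trans _ _ (\sum_i (sqint mu (S i) + \int[mu]_f sqint Q (xi i f)))%E).
    apply: lee_sum => i _.
    rewrite /sqint -(fubini_tonelli (m1 := mu) (m2 := Q) _ (mSx i)); last first.
      by move=> p; rewrite lee_fin sqr_ge0.
    rewrite -ge0_integralD//=; last 4 first.
    - by move=> f _; rewrite lee_fin sqr_ge0.
    - exact: measurable_sqr.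
    - by move=> f _; exact: sqint_ge0.
    - exact: msq.
    apply: ge0_le_integral => //.
    - by move=> f _; exact: sqint_ge0.
    - apply: (measurable_fun_fubini_tonelli_F (m2 := Q) _ (mSx i)) => p.
      by rewrite lee_fin sqr_ge0.
    - by apply: emeasurable_funD; [exact: measurable_sqr|exact: msq].
    - by move=> f _; exact: sqint_shift_le.
  rewrite big_split/= mulrSr mulrDl mul1r EFinD.
  have fS : (\sum_i sqint mu (S i))%E \is a fin_num.
    rewrite ge0_fin_numE; last by apply: sume_ge0 => i _; exact: sqint_ge0.
    by apply: le_lt_trans hxs _; exact: ltry.
  by apply: lee_ltD.
have [x Dx hx] := exists_le_average mD QD mh h0 hh.
exists (fun k => if (k < N)%N then xs k else x); split.
  by move=> k; case: ifP.
apply: le_trans hx; rewrite /h; apply: lee_sum => i _.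
rewrite (_ : (fun f => _) = (fun f => S i f + xi i f x))//.
apply/funext => f; rewrite big_ord_recr/= ltnn; congr (_ + _).
by apply: eq_bigr => k _; rewrite ltn_ord.
Qed.

End Greedy.

(** * Abstract integrals and iterated integrals *)

Import HBNNSimple.

Section FunctionalMeasure.
Context d (T : measurableType d) (R : realType).
Local Open Scope ereal_scope.

(** Daniell-style axioms for integration. They are a common interface for [itint], which is defined
    by recursion and not from a measure, and for integrals against a measure or a density. *)
Record integral_functional (Phi : (T -> \bar R) -> \bar R) : Prop := IntegralFunctional {
  if_ge0 : forall g, (forall x, 0 <= g x) -> 0 <= Phi g;
  if_0 : Phi (fun=> 0) = 0;
  if_le : forall f g, measurable_fun setT f -> measurable_fun setT g ->
    (forall x, 0 <= f x) -> (forall x, f x <= g x) -> Phi f <= Phi g;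
  if_D : forall f g, measurable_fun setT f -> measurable_fun setT g ->
    (forall x, 0 <= f x) -> (forall x, 0 <= g x) ->
    Phi (fun x => f x + g x) = Phi f + Phi g;
  if_Z : forall (k : R) g, measurable_fun setT g -> (0 <= k)%R ->
    (forall x, 0 <= g x) -> Phi (fun x => k%:E * g x) = k%:E * Phi g;
  if_cvg : forall g : nat -> T -> \bar R, (forall n, measurable_fun setT (g n)) ->
    (forall n x, 0 <= g n x) -> (forall x, nondecreasing_seq (g ^~ x)) ->
    Phi (g n) @[n --> \oo] --> Phi (fun x => limn (g ^~ x)) }.

Variables (Phi : (T -> \bar R) -> \bar R) (HPhi : integral_functional Phi).

Let nu (A : set T) : \bar R := Phi (fun x => (\1_A x)%:E).

Let nu0 : nu set0 = 0.
Proof.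
rewrite /nu -[RHS](if_0 HPhi); congr Phi; apply/funext => x.
by rewrite indic0.
Qed.

Let nu_ge0 A : 0 <= nu A.
Proof. by apply: (if_ge0 HPhi) => x; rewrite lee_fin. Qed.

Lemma if_sum (I : Type) (s : seq I) (f : I -> T -> \bar R) :
  (forall i, measurable_fun setT (f i)) -> (forall i x, 0 <= f i x) ->
  Phi (fun x => \sum_(i <- s) f i x) = \sum_(i <- s) Phi (f i).
Proof.
move=> mf f0; elim: s => [|i s ih].
  by rewrite big_nil -[RHS](if_0 HPhi); congr Phi; apply/funext => x; rewrite big_nil.
rewrite big_cons -ih -(if_D HPhi)//.
- by congr Phi; apply/funext => x; rewrite big_cons.
- exact: emeasurable_sum.
- by move=> x; exact: sume_ge0.
Qed.

Let nu_sigma_additive : semi_sigma_additive nu.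
Proof.
move=> F mF tF mUF.
have mg n : measurable_fun setT (fun x => (\1_(F n) x : R)%:E).
  exact/measurable_EFinP/measurable_indic.
pose g n x : \bar R := \sum_(0 <= i < n) (\1_(F i) x : R)%:E.
have -> : nu (\bigcup_n F n) = Phi (fun x => limn (g ^~ x)).
  congr Phi; apply/funext => x; apply/esym/cvg_lim => //.
  have [[k _ Fkx]|nF] := pselect ((\bigcup_n F n) x).
    rewrite indicE mem_set/=; last by exists k.
    apply: cvg_near_cst; exists k.+1 => // n /= kn.
    rewrite /g (bigD1_seq k) ?iota_uniq//=; last by rewrite mem_index_iota.
    rewrite indicE mem_set// big1 ?adde0// => i ik.
    rewrite indicE memNset// => Fix; move/eqP : ik; apply.
    by apply: tF => //; exists x.
  rewrite indicE memNset//=; apply: cvg_near_cst; apply: nearW => n.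
  rewrite /g big1// => i _; rewrite indicE memNset// => Fix.
  by apply: nF; exists i.
have -> : (fun n => \sum_(0 <= i < n) nu (F i)) = (fun n => Phi (g n)).
  by apply/funext => n; rewrite /g if_sum// => i x; rewrite lee_fin.
apply: (if_cvg HPhi).
- by move=> n; exact: emeasurable_sum.
- by move=> n x; apply: sume_ge0 => i _; rewrite lee_fin.
- move=> x; apply/nondecreasing_seqP => n; rewrite /g big_nat_recr//=.
  by rewrite leeDl// lee_fin.
Qed.

(** The measure is [Phi] on indicators, countably additive by [if_cvg]. Linearity carries the
    formula to simple functions, and monotone approximation to all nonnegative measurable ones. *)
Lemma integral_functional_probability : Phi (fun=> 1) = 1 ->
  exists m : probability T R, forall g, measurable_fun setT g ->
    (forall x, 0 <= g x) -> \int[m]_x g x = Phi g.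
Proof.
move=> Phi1.
have nu1 : nu setT = 1 by rewrite -[RHS]Phi1; congr Phi; apply/funext => x; rewrite indicT.
pose m0 : {measure set T -> \bar R} :=
  HB.pack nu (isMeasure.Build _ _ _ nu nu0 nu_ge0 nu_sigma_additive).
have nufin : fin_num_fun m0.
  apply: lty_fin_num_fun; rewrite [m0 _]nu1; exact: ltry.
have nusf : sigma_finite setT m0.
  by apply: fin_num_fun_sigma_finite; [rewrite [m0 _]nu0; exact: ltry|exact: nufin].
pose H1 := isFinite.Build _ _ _ _ nufin.
pose H2 := isSFinite.Build _ _ _ _ (sfinite_measure_sigma_finite nusf).
pose H3 := isSigmaFinite.Build _ _ _ _ nusf.
have nu1le : nu setT <= 1 by rewrite nu1.
pose H4 := isSubProbability.Build _ _ _ (Measure.sort m0) nu1le.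
pose H5 := isProbability.Build _ _ _ (Measure.sort m0) nu1.
pose m := HB.pack_for (probability T R) (Measure.sort m0) H1 H2 H3 H4 H5.
exists m => g mg g0.
pose h := nnsfun_approx measurableT mg.
have gE : g = fun x => limn ((fun n => (h n x)%:E)).
  by apply/funext => x; apply/esym/cvg_lim => //; exact: cvg_nnsfun_approx.
have mh n : measurable_fun setT (fun x => (h n x)%:E) by exact/measurable_EFinP.
have h0 n x : 0 <= (h n x)%:E by rewrite lee_fin.
have ndh x : nondecreasing_seq (fun n => (h n x)%:E).
  by move=> a b ab; rewrite lee_fin; exact/lefP/nd_nnsfun_approx.
have -> : \int[m]_x g x = limn (fun n => \int[m]_x (h n x)%:E).
  by rewrite [in LHS]gE monotone_convergence.
have -> : Phi g = limn (fun n => Phi (fun x => (h n x)%:E)).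
  by rewrite [in LHS]gE; apply/esym/cvg_lim => //; exact: (if_cvg HPhi).
congr (limn _); apply/funext => n.
rewrite integralT_nnsfun sintegralE.
pose A r : set T := h n @^-1` [set r].
have mA r : measurable (A r) by exact: measurable_funPTI.
pose f r x := r%:E * (\1_(A r) x : R)%:E.
(* Homogeneity of [Phi] is available for nonnegative scalars only, so the terms with a negative
   value [r] must be seen to vanish. *)
have A0 r : (r < 0)%R -> A r = set0.
  move=> r0; apply/seteqP; split => // x /= hr.
  suff : (0 <= r)%R by rewrite leNgt r0.
  by rewrite -hr; exact: fun_ge0.
have f0 r x : 0 <= f r x.
  rewrite /f; have [r0|r0] := leP 0%R r; first by rewrite mule_ge0// lee_fin.
  by rewrite A0// indic0 mule0.
have mf r : measurable_fun setT (f r).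
  by apply: measurable_funeM; apply/measurable_EFinP/measurable_indic.
transitivity (Phi (fun x => \sum_(r <- fset_set (range (h n))) f r x)); last first.
  congr Phi; apply/funext => x; rewrite (fimfunE (h n) x) -fsumEFin//.
  by rewrite fsbig_finite.
rewrite if_sum// fsbig_finite//; apply: eq_bigr => r _.
rewrite /f; have [r0|r0] := leP 0%R r.
  by rewrite (if_Z HPhi)//; exact/measurable_EFinP/measurable_indic.
rewrite -/(A r) A0// measure0 mule0 -[LHS](if_0 HPhi); congr Phi; apply/funext => x.
by rewrite indic0 mule0.
Qed.

End FunctionalMeasure.

(** * The iterated Lebesgue integral as an integral functional *)

Section IteratedIntegral.
Variable R : realType.
Local Open Scope ereal_scope.

Lemma measurable_cons_pair d (X : measurableType d) n :
  measurable_fun setT (fun p : (X * R) * n.-tuple R => (p.1.1, [tuple of p.1.2 :: p.2])).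
Proof.
apply: measurable_fun_pair; first exact: measurableT_comp.
by apply: measurable_cons => //; exact: measurableT_comp.
Qed.

Lemma itint_ge0 n (g : n.-tuple R -> \bar R) : (forall t, 0 <= g t) -> 0 <= itint g.
Proof.
elim: n g => [|n ih] g g0 //=.
by apply: integral_ge0 => x _; exact: ih.
Qed.

(** The parameter space [X] is arbitrary because the induction moves the first coordinate of the
    tuple into it: the inner integral is measurable on [X * R], and Tonelli then integrates that
    coordinate out. *)
Lemma measurable_itint d (X : measurableType d) n (g : X * n.-tuple R -> \bar R) :
  measurable_fun setT g -> (forall p, 0 <= g p) ->
  measurable_fun setT (fun x => itint (fun t => g (x, t))).
Proof.
elim: n d X g => [|n ih] d X g mg g0 /=.
  by apply: measurableT_comp mg _; exact: pair2_measurable.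
pose h (p : X * R) := itint (fun t : n.-tuple R => g (p.1, [tuple of p.2 :: t])).
apply: (measurable_fun_fubini_tonelli_F (m2 := lebesgue_measure) h).
- apply: (ih _ _ (fun p => g (p.1.1, [tuple of p.1.2 :: p.2]))) => //.
  by apply: measurableT_comp mg _; exact: measurable_cons_pair.
- by move=> p; exact: itint_ge0.
Qed.

Lemma measurable_itint_cons n (g : n.+1.-tuple R -> \bar R) :
  measurable_fun setT g -> (forall t, 0 <= g t) ->
  measurable_fun setT (fun x => itint (fun t : n.-tuple R => g [tuple of x :: t])).
Proof.
move=> mg g0.
apply: (@measurable_itint _ R n (fun p => g [tuple of p.1 :: p.2])) => //.
by apply: measurableT_comp mg _; exact: measurable_cons.
Qed.

Lemma measurable_consr n (g : n.+1.-tuple R -> \bar R) x :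
  measurable_fun setT g -> measurable_fun setT (fun t : n.-tuple R => g [tuple of x :: t]).
Proof. by move=> mg; apply: measurableT_comp mg _; exact: measurable_cons. Qed.

Lemma itint_functional n : integral_functional (@itint R n).
Proof.
elim: n => [|n ih]; split => //=.
- move=> g mg g0 ndg; apply: ereal_nondecreasing_is_cvgn.
  exact: ndg.
- exact: (@itint_ge0 n.+1).
- by under eq_integral do rewrite (if_0 ih); rewrite integral0.
- move=> f g mf mg f0 fg; apply: ge0_le_integral => //.
  + by move=> x _; exact: itint_ge0.
  + exact: measurable_itint_cons.
  + apply: measurable_itint_cons => // t; exact: le_trans (f0 t) (fg t).
  + by move=> x _; apply: (if_le ih) => //; exact: measurable_consr.
- move=> f g mf mg f0 g0.
  rewrite -ge0_integralD//=.
  + apply: eq_integral => x _; rewrite (if_D ih)//; exact: measurable_consr.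
  + by move=> x _; exact: itint_ge0.
  + exact: measurable_itint_cons.
  + by move=> x _; exact: itint_ge0.
  + exact: measurable_itint_cons.
- move=> k g mg k0 g0; rewrite -ge0_integralZl//=.
  + by apply: eq_integral => x _; rewrite (if_Z ih)//; exact: measurable_consr.
  + exact: measurable_itint_cons.
  + by move=> x _; exact: itint_ge0.
- move=> g mg g0 ndg.
  rewrite [X in _ --> X](_ : _ = \int[lebesgue_measure]_x
      limn (fun k => itint (fun t : n.-tuple R => g k [tuple of x :: t]))); last first.
    apply: eq_integral => x _; apply/esym/cvg_lim => //.
    by apply: (if_cvg ih (g := fun k t => g k _)) => [k|k t|t] //; exact: measurable_consr.
  apply: cvg_monotone_convergence => //.
  + by move=> k; exact: measurable_itint_cons.
  + by move=> k x _; exact: itint_ge0.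
  + move=> x _ a b ab; apply: (if_le ih) => //; try exact: measurable_consr.
    by move=> t; exact: ndg.
Qed.

End IteratedIntegral.

Section WeightedProbability.
Context d (T : measurableType d) (R : realType).
Local Open Scope ereal_scope.

Lemma measure_functional (m : {measure set T -> \bar R}) :
  integral_functional (fun g => \int[m]_x g x).
Proof.
split.
- by move=> g g0; exact: integral_ge0.
- exact: integral0.
- by move=> f g mf mg f0 fg; apply: ge0_le_integral.
- by move=> f g mf mg f0 g0; rewrite ge0_integralD.
- by move=> k g mg k0 g0; rewrite ge0_integralZl.
- by move=> g mg g0 ndg; exact: cvg_monotone_convergence.
Qed.

Lemma weighted_functional (Phi : (T -> \bar R) -> \bar R) (w : T -> R) :
  integral_functional Phi -> measurable_fun setT w -> (forall x, 0 <= w x)%R ->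
  integral_functional (fun g => Phi (fun x => (w x)%:E * g x)).
Proof.
move=> HPhi mw w0.
have mwg g : measurable_fun setT g -> measurable_fun setT (fun x => (w x)%:E * g x).
  by move=> mg; apply: emeasurable_funM => //; exact/measurable_EFinP.
have wg0 g : (forall x, 0 <= g x) -> forall x, 0 <= (w x)%:E * g x.
  by move=> g0 x; rewrite mule_ge0// lee_fin.
split.
- by move=> g g0; apply: (if_ge0 HPhi); exact: wg0.
- by rewrite -[RHS](if_0 HPhi); congr Phi; apply/funext => x; rewrite mule0.
- move=> f g mf mg f0 fg; apply: (if_le HPhi); [exact: mwg|exact: mwg|exact: wg0|].
  by move=> x; rewrite lee_wpmul2l// lee_fin.
- move=> f g mf mg f0 g0; rewrite -(if_D HPhi); [|exact: mwg|exact: mwg|exact: wg0|exact: wg0].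
  by congr Phi; apply/funext => x; rewrite ge0_muleDr.
- move=> k g mg k0 g0; rewrite -(if_Z HPhi); [|exact: mwg|by []|exact: wg0].
  by congr Phi; apply/funext => x; rewrite muleCA.
- move=> g mg g0 ndg.
  rewrite [X in _ --> Phi X](_ : _ = fun x => limn (fun n => (w x)%:E * g n x)).
    apply: (if_cvg HPhi) => [n|n|x]; [exact: mwg|exact: wg0|].
    by move=> a b ab; rewrite lee_wpmul2l ?lee_fin//; exact: ndg.
  apply/funext => x; apply/esym/cvg_lim => //; apply: cvgeZl => //.
  exact: ereal_nondecreasing_is_cvgn.
Qed.

(** Serves three times: for [rho] against the iterated integral, for the sampling density, and for
    the normal density. *)
Lemma weighted_probability (Phi : (T -> \bar R) -> \bar R) (w : T -> R) :
  integral_functional Phi -> measurable_fun setT w -> (forall x, 0 <= w x)%R ->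
  Phi (EFin \o w) = 1 ->
  exists Q : probability T R, forall g, measurable_fun setT g -> (forall x, 0 <= g x) ->
    \int[Q]_x g x = Phi (fun x => (w x)%:E * g x).
Proof.
move=> HPhi mw w0 w1.
apply: (integral_functional_probability (weighted_functional HPhi mw w0)).
by rewrite -[RHS]w1; congr Phi; apply/funext => x /=; rewrite mule1.
Qed.

End WeightedProbability.

Section Density.
Context d (T : measurableType d) (R : realType).
Variables (m Q : probability T R) (w : T -> R).
Hypothesis w0 : forall x, 0 <= w x.
Hypothesis QE : forall g : T -> \bar R, measurable_fun setT g -> (forall x, (0 <= g x)%E) ->
    (\int[Q]_x g x = \int[m]_x ((w x)%:E * g x))%E.

Lemma density_integrable (u : T -> R) : measurable_fun setT u ->
  m.-integrable setT (fun x => (w x * u x)%:E) -> Q.-integrable setT (EFin \o u).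
Proof.
move=> mu /integrableP[_ h]; apply/integrableP; split; first exact/measurable_EFinP.
rewrite QE//; last by apply/measurable_EFinP; exact: measurableT_comp.
apply: le_lt_trans h; rewrite le_eqVlt; apply/orP; left; apply/eqP.
by apply: eq_integral => x _ /=; rewrite normrM (ger0_norm (w0 x)) EFinM.
Qed.

(** As [w] is nonnegative, the positive and negative parts of [w u] are [w] times those of [u], and
    [QE] applies to each. *)
Lemma density_Rintegral (u : T -> R) : measurable_fun setT u ->
  \int[Q]_x u x = \int[m]_x (w x * u x).
Proof.
move=> mu; rewrite /Rintegral; congr fine.
rewrite integralE [in RHS]integralE.
rewrite !QE//; last 2 first.
- by apply: measurable_funeneg; exact/measurable_EFinP.
- by apply: measurable_funepos; exact/measurable_EFinP.
congr (_ - _)%E; apply: eq_integral => x _; rewrite ?funeposE ?funenegE -?EFin_max -?EFinN -?EFinM.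
  by rewrite maxr_pMr// mulr0.
by rewrite maxr_pMr// mulr0 mulrN.
Qed.

End Density.

(** * Orthonormal families *)

Section FiniteDimensional.
Variable R : realType.

(** Lagrange's identity: the difference of the two sides is half the sum of all
    [(a i * c j - a j * c i) ^+ 2]. *)
Lemma sum_sqr_mul_le (I : finType) (a c : I -> R) :
  (\sum_i a i * c i) ^+ 2 <= (\sum_i a i ^+ 2) * (\sum_i c i ^+ 2).
Proof.
rewrite -subr_ge0.
have : 0 <= \sum_i \sum_j (a i * c j - a j * c i) ^+ 2.
  by do 2 (apply: sumr_ge0 => ? _); exact: sqr_ge0.
have -> : \sum_i \sum_j (a i * c j - a j * c i) ^+ 2 =
    2 * ((\sum_i a i ^+ 2) * (\sum_i c i ^+ 2) - (\sum_i a i * c i) ^+ 2).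
  transitivity ((\sum_i a i ^+ 2) * (\sum_i c i ^+ 2) + (\sum_i c i ^+ 2) * (\sum_i a i ^+ 2)
      - 2 * ((\sum_i a i * c i) * (\sum_i a i * c i))); last by ring.
  rewrite !big_distrlr/= mulr_sumr -big_split -sumrB; apply: eq_bigr => i _.
  rewrite mulr_sumr -big_split -sumrB; apply: eq_bigr => j _ /=.
  by ring.
by rewrite pmulr_rge0.
Qed.

(** For [q = c G - c] the hypothesis gives [|q|^2 <= |c|^2 / 4], and [|c|^2 <= 2 |c G|^2 + 2 |q|^2].
    The last term is at most [|c|^2 / 2] and is absorbed on the left, which doubles the factor 2. *)
Lemma near_identity_bound m (G : 'M[R]_m) :
  \sum_i \sum_j (G i j - (i == j)%:R) ^+ 2 <= 4^-1 ->
  forall c : 'rV[R]_m, \sum_j (c 0 j) ^+ 2 <= 4 * \sum_j ((c *m G) 0 j) ^+ 2.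
Proof.
move=> hG c.
pose q j := \sum_i c 0 i * (G i j - (i == j)%:R).
have qE j : q j = (c *m G) 0 j - c 0 j.
  rewrite /q mxE; under eq_bigr do rewrite mulrBr.
  rewrite sumrB; congr (_ - _); rewrite (bigD1 j)//= eqxx mulr1 big1 ?addr0// => i ij.
  by rewrite (negbTE ij) mulr0.
have hq : \sum_j q j ^+ 2 <= 4^-1 * \sum_j c 0 j ^+ 2.
  apply: (@le_trans _ _ (\sum_j (\sum_i c 0 i ^+ 2) * (\sum_i (G i j - (i == j)%:R) ^+ 2))).
    by apply: ler_sum => j _; exact: sum_sqr_mul_le.
  rewrite -mulr_sumr mulrC exchange_big/=; apply: ler_wpM2r => //.
  by apply: sumr_ge0 => i _; exact: sqr_ge0.
have h : \sum_j c 0 j ^+ 2 <= 2 * (\sum_j ((c *m G) 0 j) ^+ 2) + 2 * \sum_j q j ^+ 2.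
  rewrite !mulr_sumr -big_split/=; apply: ler_sum => j _.
  rewrite -(sqrrN (q j)); apply: le_trans (sqrD_le2 _ _).
  by rewrite qE opprB addrC subrK.
lra.
Qed.

Lemma near_identity_unitmx m (G : 'M[R]_m) :
  \sum_i \sum_j (G i j - (i == j)%:R) ^+ 2 <= 4^-1 -> G \in unitmx.
Proof.
move=> /near_identity_bound hG; rewrite -row_free_unit -kermx_eq0.
apply/rowV0P => v /sub_kermxP vG.
apply/rowP => j; rewrite mxE; have := hG v; rewrite vG.
rewrite [X in _ <= 4 * X]big1 ?mulr0 => [h|k _]; last by rewrite mxE expr0n.
have : \sum_j v 0 j ^+ 2 == 0.
  by rewrite eq_le h/=; apply: sumr_ge0 => k _; exact: sqr_ge0.
rewrite psumr_eq0 => [/allP/(_ j)|k _]; last exact: sqr_ge0.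
by rewrite mem_index_enum sqrf_eq0 => /(_ isT)/eqP.
Qed.

End FiniteDimensional.

Section MaximalOrthonormal.
Context d (T : measurableType d) (R : realType) (m : {measure set T -> \bar R}).
Variables (n : nat) (a : 'I_n -> T -> R).

Let comb (v : 'I_n -> R) x := \sum_i v i * a i x.

Let orthonormal (k : nat) (A : nat -> 'I_n -> R) :=
  (forall j, (j < k)%N -> L2 m (comb (A j))) /\
  (forall i j, (i < k)%N -> (j < k)%N -> ip m (comb (A i)) (comb (A j)) = (i == j)%:R).

(** Orthonormality makes the coefficient rows linearly independent, since a relation among rows is a
    relation among functions. The resulting bound guarantees that a system of maximal size
    exists. *)
Let orthonormal_le k A : orthonormal k A -> (k <= n)%N.
Proof.
move=> [LA oA]; rewrite leqNgt; apply/negP => nk.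
pose M : 'M[R]_(k, n) := \matrix_(j, i) A j i.
have /negP : ~~ row_free M.
  by rewrite /row_free neq_ltn (leq_ltn_trans (rank_leq_col M) nk).
rewrite -kermx_eq0; apply; apply/rowV0P => v /sub_kermxP vM.
apply/rowP => l; rewrite mxE.
have LAk (j : 'I_k) : L2 m (comb (A j)) by exact: LA.
have : ip m (fun x => \sum_(j < k) v 0 j * comb (A j) x) (comb (A l)) = 0.
  rewrite (_ : (fun x => _) = (fun=> 0)).
    by rewrite /ip; under eq_Rintegral do rewrite mul0r; rewrite /Rintegral integral0.
  apply/funext => x; rewrite /comb; under eq_bigr do rewrite mulr_sumr.
  rewrite exchange_big/= big1// => i _.
  under eq_bigr do rewrite mulrA.
  rewrite -mulr_suml (_ : \sum_(j < k) _ = 0) ?mul0r//.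
  transitivity ((v *m M) 0 i); last by rewrite vM mxE.
  by rewrite mxE; apply: eq_bigr => j _; rewrite mxE.
rewrite ip_suml => [|j|]; [|exact: L2Z|by []].
under eq_bigr do rewrite ipZl// oA//.
rewrite (bigD1 l)//= eqxx mulr1 big1 ?addr0// => j jl.
by rewrite (_ : (j == l :> nat) = false) ?mulr0//; exact: negbTE.
Qed.

(** A residual of positive norm could be normalised and appended. Only square integrable
    combinations are tested, so a single [a i] may fail to be square integrable. *)
Lemma maximal_orthonormal : exists k (A : nat -> 'I_n -> R),
  [/\ (k <= n)%N, orthonormal k A &
   forall v, L2 m (comb v) ->
   let r x := comb v x - \sum_(j < k) ip m (comb v) (comb (A j)) * comb (A j) x in
   ip m r r = 0].
Proof.
have ex0 : exists k, `[< exists A, orthonormal k A >].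
  exists 0%N; apply/asboolP; exists (fun _ _ => 0).
  by split=> [j|i j]; rewrite ltn0.
have bd k : `[< exists A, orthonormal k A >] -> (k <= n)%N.
  by move=> /asboolP[A]; exact: orthonormal_le.
case: (ex_maxnP ex0 bd) => k /asboolP[A [LA oA]] kmax.
exists k, A; split => [||v Lv r]; [exact: (@orthonormal_le _ A)|by []|].

have LAk (j : 'I_k) : L2 m (comb (A j)) by exact: LA.
have Ls : L2 m (fun x => \sum_(j < k) ip m (comb v) (comb (A j)) * comb (A j) x).
  by apply: L2_sum => j; exact: L2Z.
have Lr : L2 m r by exact: L2B.
have rA (l : 'I_k) : ip m r (comb (A l)) = 0.
  rewrite ipBl// [X in _ - X]ip_suml => [|j|]; [|exact: L2Z|by []].
  under eq_bigr do rewrite ipZl// oA//.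
  rewrite (bigD1 l)//= eqxx mulr1 big1 ?addr0 ?subrr// => j jl.
  by rewrite (_ : (j == l :> nat) = false) ?mulr0//; exact: negbTE.
apply/eqP/negPn/negP => r0.
have rpos : 0 < ip m r r by rewrite lt_neqAle eq_sym r0 ip_ge0.
pose s := (Num.sqrt (ip m r r))^-1.
have s2 : s * (s * ip m r r) = 1.
  by rewrite mulrA -invfM -expr2 sqr_sqrtr ?ip_ge0// mulVf.
(* Coefficients of the normalised residual in the generators, which keeps the enlarged system inside
   the span. *)
pose v' i := s * (v i - \sum_(j < k) ip m (comb v) (comb (A j)) * A j i).
have v'E : comb v' = fun x => s * r x.
  apply/funext => x; rewrite /comb /v' /r.
  under eq_bigr do rewrite -mulrA mulrBl mulr_suml.
  rewrite -mulr_sumr sumrB exchange_big/=; congr (_ * (_ - _)).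
  apply: eq_bigr => j _; rewrite /comb mulr_sumr.
  by apply: eq_bigr => i _; rewrite mulrA.
suff : (k.+1 <= k)%N by rewrite ltnn.
apply: kmax; apply/asboolP; exists (fun j => if (j < k)%N then A j else v'); split.
  move=> j _; case: ifP => jk; first exact: LA.
  by rewrite v'E; exact: L2Z.
move=> i j; rewrite !ltnS => ik jk.
case: ifPn => ik'; case: ifPn => jk'.
- exact: oA.
- have -> : j = k by apply/eqP; rewrite eqn_leq jk leqNgt.
  rewrite (ltn_eqF ik') v'E ipZr//; last exact: LA.
  by rewrite ipC (rA (Ordinal ik')) mulr0.
- have -> : i = k by apply/eqP; rewrite eqn_leq ik leqNgt.
  rewrite (gtn_eqF jk') v'E ipZl//; last exact: LA.
  by rewrite (rA (Ordinal jk')) mulr0.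
- have -> : i = k by apply/eqP; rewrite eqn_leq ik leqNgt.
  have -> : j = k by apply/eqP; rewrite eqn_leq jk leqNgt.
  by rewrite eqxx v'E ipZl ?ipZr//; exact: L2Z.
Qed.

End MaximalOrthonormal.

Section Projection.
Context d (T : measurableType d) (R : realType) (m : {measure set T -> \bar R}).
Variables (k : nat) (e : 'I_k -> T -> R).
Hypothesis Le : forall j, L2 m (e j).
Hypothesis oe : forall i j, ip m (e i) (e j) = (i == j)%:R.

Definition residual (u : T -> R) x := u x - \sum_j ip m u (e j) * e j x.

Lemma L2_comb (c : 'I_k -> R) : L2 m (fun x => \sum_j c j * e j x).
Proof. by apply: L2_sum => j; exact: L2Z. Qed.

Lemma L2_residual u : L2 m u -> L2 m (residual u).
Proof. by move=> Lu; apply: L2B => //; exact: L2_comb. Qed.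

Lemma ip_comb (c : 'I_k -> R) l : ip m (fun x => \sum_j c j * e j x) (e l) = c l.
Proof.
rewrite ip_suml => [|j|]; [|exact: L2Z|by []].
under eq_bigr do rewrite ipZl// oe.
by rewrite (bigD1 l)//= eqxx mulr1 big1 ?addr0// => j /negbTE ->; rewrite mulr0.
Qed.

Lemma ip_residual u l : L2 m u -> ip m (residual u) (e l) = 0.
Proof. by move=> Lu; rewrite ipBl//; [rewrite ip_comb subrr|exact: L2_comb]. Qed.

Lemma sqint_comb (c : 'I_k -> R) :
  sqint m (fun x => \sum_j c j * e j x) = (\sum_j c j ^+ 2)%:E.
Proof.
rewrite sqintE; last exact: L2_comb.
rewrite ip_sumr => [|j|]; [|exact: L2Z|exact: L2_comb].
congr EFin; apply: eq_bigr => j _.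
by rewrite ipZr ?ip_comb//; exact: L2_comb.
Qed.

(** If [u - h] has infinite norm there is nothing to show. Otherwise [h] is square integrable and
    its own residual has norm zero, so [u - h] is the residual of [u] plus a function [q] orthogonal
    to it: Pythagoras. *)
Lemma residual_optimal u h : L2 m u -> measurable_fun setT h ->
  (L2 m h -> ip m (residual h) (residual h) = 0) ->
  (sqint m (residual u) <= sqint m (fun x => u x - h x)%R)%E.
Proof.
move=> Lu mh hr.
have := leey (sqint m (fun x => u x - h x)); rewrite le_eqVlt => /predU1P[->|huh].
  by rewrite leey.
have mu : measurable_fun setT u by case: Lu.
have Luh : L2 m (fun x => u x - h x) by split => //; exact: measurable_funB.
have Lh : L2 m h.
  have := L2B Lu Luh; congr L2; apply/funext => x.
  by rewrite opprB addrC subrK.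
have {}hr := hr Lh.
have Lg := L2_residual Lu; have Lr := L2_residual Lh.
pose c j := ip m u (e j) - ip m h (e j).
pose q x := (\sum_j c j * e j x) - residual h x.
have Lq : L2 m q by apply: L2B => //; exact: L2_comb.
have gq : ip m (residual u) q = 0.
  rewrite ipBr//; last exact: L2_comb.
  rewrite (ipC _ _ (residual h)) (ip_eq0_ae Lr)// subr0.
  rewrite ip_sumr => [|j|//]; last exact: L2Z.
  by rewrite big1// => j _; rewrite ipZr// ip_residual// mulr0.
have -> : (fun x => u x - h x) = (fun x => residual u x + q x).
  apply/funext => x; rewrite /q /residual /c.
  under [X in _ + (X - _)]eq_bigr do rewrite mulrBl.
  by rewrite sumrB; ring.
rewrite !sqintE//; last exact: L2D.
rewrite lee_fin (ipDl Lg Lq (L2D Lg Lq)) (ipDr Lg Lq Lg) (ipDr Lg Lq Lq).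
by rewrite gq (ipC _ q) gq addr0 add0r lerDl ip_ge0.
Qed.

End Projection.

Lemma measurable_Rintegral_param dF (F : measurableType dF) d (T : measurableType d)
    (R : realType) (nu : probability T R) (Y : F -> T -> R) :
  measurable_fun setT (fun p : F * T => Y p.1 p.2) ->
  measurable_fun setT (fun f => \int[nu]_x Y f x).
Proof.
move=> mY; rewrite /Rintegral; apply: (measurableT_comp (fine_measurable measurableT)).
have mY' : measurable_fun setT (fun p : F * T => (Y p.1 p.2)%:E) by exact/measurable_EFinP.
under eq_fun do rewrite integralE.
apply: emeasurable_funB.
- rewrite [X in measurable_fun _ X](_ : _ = fubini_F nu (fun p : F * T => (Y p.1 p.2)%:E)^\+%E).
    apply: measurable_fun_fubini_tonelli_F; first exact: measurable_funepos.
    by move=> p; exact: funepos_ge0.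
  by apply/funext => f; apply: eq_integral => x _; rewrite !funeposE.
- rewrite [X in measurable_fun _ X](_ : _ = fubini_F nu (fun p : F * T => (Y p.1 p.2)%:E)^\-%E).
    apply: measurable_fun_fubini_tonelli_F; first exact: measurable_funeneg.
    by move=> p; exact: funeneg_ge0.
  by apply/funext => f; apply: eq_integral => x _; rewrite !funenegE.
Qed.

Lemma measurable_sqint_param dF (F : measurableType dF) d (T : measurableType d)
    (R : realType) (nu : probability T R) (Y : F -> T -> R) :
  measurable_fun setT (fun p : F * T => Y p.1 p.2) ->
  measurable_fun setT (fun f => sqint nu (Y f)).
Proof.
move=> mY.
apply: (measurable_fun_fubini_tonelli_F (m2 := nu) (fun p : F * T => ((Y p.1 p.2) ^+ 2)%:E)).
  by apply: measurable_sqr.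
by move=> p; rewrite lee_fin sqr_ge0.
Qed.

(** * Least squares at greedily chosen points *)

Section SampledLeastSquares.
Context dF (F : measurableType dF) d (T : measurableType d) (R : realType).
Variables (mu : probability F R) (nu : probability T R) (X : F -> T -> R).
Hypothesis mX : measurable_fun setT (fun p : F * T => X p.1 p.2).
Hypothesis LX : forall f, L2 nu (X f).
Variables (k : nat) (e : 'I_k -> T -> R).
Hypothesis Le : forall j, L2 nu (e j).
Hypothesis oe : forall i j, ip nu (e i) (e j) = (i == j)%:R.
Hypothesis k0 : (0 < k)%N.

Let g f := residual nu e (X f).

Let me_ j : measurable_fun setT (e j). Proof. by case: (Le j). Qed.

Lemma measurable_residual : measurable_fun setT (fun p : F * T => g p.1 p.2).
Proof.
apply: measurable_funB => //; apply: measurable_sum => j.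
apply: measurable_funM; last exact: measurableT_comp.
apply: (measurableT_comp (f := fun f => ip nu (X f) (e j))) => //.
apply: (measurable_Rintegral_param nu (Y := fun f x => X f x * e j x)).
by apply: measurable_funM => //; exact: measurableT_comp.
Qed.

(* The sampling density relative to [nu]: the normalised Christoffel function. *)
Let w x := k%:R^-1 * \sum_j e j x ^+ 2.

Let kR : (k%:R : R) != 0. Proof. by rewrite pnatr_eq0 -lt0n. Qed.

Let w0 x : 0 <= w x.
Proof. by rewrite mulr_ge0 ?invr_ge0// sumr_ge0// => j _; exact: sqr_ge0. Qed.

Let kw x : \sum_j e j x ^+ 2 = k%:R * w x.
Proof. by rewrite /w mulrA mulfV// mul1r. Qed.

Let mw : measurable_fun setT w.
Proof. by apply: measurable_funM => //; apply: measurable_sum => j; exact: measurable_funX. Qed.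

(** Quotients by [w] are 0 where [w] vanishes, since division by zero gives 0. Because every [e j]
    vanishes there too, multiplying back by [w] still returns the numerators used below. *)
Let w_eq0 x j : w x = 0 -> e j x = 0.
Proof.
move=> wx; have := kw x; rewrite wx mulr0 => /eqP.
rewrite psumr_eq0 => [/allP/(_ j)|i _]; last exact: sqr_ge0.
by rewrite mem_index_enum sqrf_eq0 => /(_ isT)/eqP.
Qed.

Let int_w : (\int[nu]_x (w x)%:E = 1)%E.
Proof.
under eq_integral do rewrite /w EFinM -sumEFin.
rewrite ge0_integralZl//; first last.
- by move=> x _; apply: sume_ge0 => j _; rewrite lee_fin sqr_ge0.
- by apply: emeasurable_sum => j; exact: measurable_sqr.
rewrite ge0_integral_sum//; first last.
- by move=> j x _; rewrite lee_fin sqr_ge0.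
- by move=> j; exact: measurable_sqr.
under eq_bigr => j _ do rewrite -/(sqint nu (e j)) sqintE// oe eqxx.
by rewrite sumEFin sumr_const card_ord -EFinM mulVf.
Qed.

(** The reconstruction from samples is the projection plus a span element with coefficients
    [beta G^-1], of norm at most [2 |beta|]. The error is thus [g f] minus that element, and
    [2 E + 2 * 4 * (E / 4) = 4 E]. *)
Lemma christoffel_sampling (D : set T) (E : R) : measurable D -> nu D = 1%E -> 0 < E ->
  (\int[mu]_f sqint nu (g f) < E%:E)%E ->
  let N := (4 * k.+1 ^ 4)%N in
  exists (xs : nat -> T) (b : nat -> T -> R),
  [/\ forall i, D (xs i), forall i, measurable_fun setT (b i) &
   (\int[mu]_f sqint nu (fun x => X f x - \sum_(i < N) X f (xs i) * b i x)%R
     <= (4 * E)%:E)%E].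
Proof.
move=> mD nuD E0 hE N.
have w1 : (\int[nu]_x (EFin \o w) x = 1)%E by [].
have [Q QE] := weighted_probability (measure_functional nu) mw w0 w1.
pose D0 := D `&` [set x | 0 < w x].
have mD0 : measurable D0.
  apply: measurableI => //.
  rewrite (_ : [set x | _] = w @^-1` `]0, +oo[).
    by rewrite -[X in measurable X]setTI; exact: mw.
  by apply/seteqP; split => x /=; rewrite in_itv/= andbT.
(* [Q] has density [w] with respect to [nu], so it charges neither the complement of [D] nor the
   zeros of [w]. *)
have QD0 : Q D0 = 1%E.
  have nuDC : nu (~` D) = 0%E.
    by rewrite probability_setC// nuD subee.
  rewrite -(setIT D0) -integral_indic// QE//; last exact/measurable_EFinP/measurable_indic.
  transitivity (\int[nu]_(x in setT `\` ~` D) (w x)%:E)%E; last first.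
    rewrite -ge0_negligible_integral//; first exact: measurableC.
      exact/measurable_EFinP.
    by move=> x _; rewrite lee_fin.
  rewrite (ge0_negligible_integral _ _ _ _ nuDC)//; first last.
  - by move=> x _; rewrite -EFinM lee_fin mulr_ge0.
  - rewrite -[X in measurable_fun _ X]/(EFin \o (w \* \1_D0)%R).
    by apply/measurable_EFinP/measurable_funM => //; exact: measurable_indic.
  - exact: measurableC.
  apply: eq_integral => x /set_mem; rewrite setTD setCK => Dx.
  rewrite -EFinM; congr EFin.
  have := w0 x; rewrite le_eqVlt => /predU1P[<-|wx]; first by rewrite mul0r.
  by rewrite indicE mem_set ?mulr1.
pose M i j x := e i x * e j x / w x.
have wM i j x : w x * M i j x = e i x * e j x.
  rewrite /M; have [wx|wx] := eqVneq (w x) 0.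
    by rewrite (w_eq0 i wx) !mul0r mulr0.
  by rewrite mulrC divfK.
have mwV : measurable_fun setT (fun x => (w x)^-1).
  under eq_fun do rewrite -powR_inv1//.
  exact: (measurableT_comp (measurable_powR _)).
have mM i j : measurable_fun setT (M i j).
  by apply: measurable_funM => //; exact: measurable_funM.
(* From [|e_i e_j| <= sum_l e_l^2 = k w]. This uniform bound, valid for every orthonormal system, is
   the reason for sampling from the Christoffel density. *)
have Mle i j x : `|M i j x| <= k%:R.
  have [wx|wx] := eqVneq (w x) 0; first by rewrite /M (w_eq0 i wx) !mul0r normr0.
  have wpos : 0 < w x by rewrite lt_neqAle eq_sym wx w0.
  rewrite /M normrM normfV (gtr0_norm wpos) ler_pdivrMr// -kw.
  have h l : e l x ^+ 2 <= \sum_j e j x ^+ 2.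
    by rewrite (bigD1 l)//= lerDl sumr_ge0// => ? _; exact: sqr_ge0.
  rewrite normrM; have := h i; have := h j.
  rewrite -(real_normK (num_real (e i x))) -(real_normK (num_real (e j x))).
  nra.
have intM i j : Q.-integrable setT (EFin \o M i j).
  apply: (density_integrable w0 QE) => //.
  by under eq_fun do rewrite wM; exact: L2_mul_integrable.
have RintM i j : \int[Q]_x M i j x = (i == j)%:R.
  by rewrite (density_Rintegral w0 QE)//; under eq_Rintegral do rewrite wM; exact: oe.
pose B j f x := g f x * e j x / w x.
have wB j f x : w x * B j f x = g f x * e j x.
  rewrite /B; have [wx|wx] := eqVneq (w x) 0.
    by rewrite (w_eq0 j wx) mulr0 mul0r mulr0.
  by rewrite mulrC divfK.
have mB j : measurable_fun setT (fun p : F * T => B j p.1 p.2).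
  apply: measurable_funM; last exact: (measurableT_comp mwV).
  apply: measurable_funM; first exact: measurable_residual.
  exact: measurableT_comp.
have Lg f : L2 nu (g f) by exact: L2_residual.
have mBf j f : measurable_fun setT (B j f) by exact: (measurable_sec2 f (mB j)).
have intB j f : Q.-integrable setT (EFin \o B j f).
  apply: (density_integrable w0 QE) => //.
  by under eq_fun do rewrite wB; exact: L2_mul_integrable.
have RintB j f : \int[Q]_x B j f x = 0.
  rewrite (density_Rintegral w0 QE)//; under eq_Rintegral do rewrite wB.
  exact: ip_residual.
(* Where [w] is positive, the sum of the [B j f ^+ 2] is [k g^2 / w], and the density [w] of [Q]
   cancels the denominator. *)
have sqB f : (\sum_j sqint Q (B j f) <= k%:R%:E * sqint nu (g f))%E.
  rewrite /sqint -ge0_integral_sum//; first last.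
  - by move=> j x _; rewrite lee_fin sqr_ge0.
  - by move=> j; exact: measurable_sqr.
  rewrite QE; first last.
  - by move=> x; apply: sume_ge0 => j _; rewrite lee_fin sqr_ge0.
  - by apply: emeasurable_sum => j; exact: measurable_sqr.
  have mg : measurable_fun setT (g f) by case: (Lg f).
  rewrite -ge0_integralZl//; first last.
  - by move=> x _; rewrite lee_fin sqr_ge0.
  - exact: measurable_sqr.
  apply: ge0_le_integral => //.
  - move=> x _; rewrite mule_ge0 ?lee_fin//.
    by apply: sume_ge0 => j _; rewrite lee_fin sqr_ge0.
  - apply: emeasurable_funM; first exact/measurable_EFinP.
    by apply: emeasurable_sum => j; exact: measurable_sqr.
  - by apply: measurable_funeM; exact: measurable_sqr.
  - move=> x _; rewrite sumEFin -!EFinM lee_fin mulr_sumr.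
    have [wx|wx] := eqVneq (w x) 0.
      rewrite big1 => [|j _]; last by rewrite wx mul0r.
      by rewrite mulr_ge0 ?sqr_ge0.
    rewrite (_ : \sum_j _ = (g f x) ^+ 2 / w x * \sum_j e j x ^+ 2).
      by rewrite kw le_eqVlt; apply/orP; left; apply/eqP; field.
    by rewrite mulr_sumr; apply: eq_bigr => j _; rewrite /B; field.
(* Rescaling makes the residual terms independent of [E], so that one greedy run controls them
   together with the Gram deviations. *)
pose s := Num.sqrt E^-1.
have s2 : s ^+ 2 = E^-1 by rewrite sqr_sqrtr// invr_ge0 ltW.
pose xi (i : ('I_k * 'I_k) + 'I_k) (f : F) (x : T) : R :=
  match i with
  | inl p => M p.1 p.2 x - (p.1 == p.2)%:R
  | inr j => s * B j f x
  end.
(* Chosen for [k^2 (k+1)^2 + k < (k+1)^4]; the greedy selection needs this inequality to be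
   strict. *)
pose K : R := k.+1%:R ^+ 4.
have mxi i : measurable_fun setT (fun p : F * T => xi i p.1 p.2).
  case: i => [[i j]|j] /=; last exact: measurable_funM.
  by apply: measurable_funB => //; exact: (measurableT_comp (mM i j)).
have ixi i f : Q.-integrable setT (EFin \o xi i f).
  case: i => [[i j]|j] /=.
    rewrite (_ : _ \o _ = (EFin \o M i j) \- (EFin \o cst (i == j)%:R))%E//.
    by apply: integrableB => //; exact: finite_measure_integrable_cst.
  rewrite (_ : _ \o _ = (fun x => s%:E * (EFin \o B j f) x)%E)//.
  exact: integrableZl.
have xi0 i f : \int[Q]_x xi i f x = 0.
  case: i => [[i j]|j] /=.
    rewrite RintegralB ?RintM ?Rintegral_cst//; last exact: finite_measure_integrable_cst.
    by rewrite [X in fine X]probability_setT mulr1 subrr.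
  by rewrite RintegralZl// RintB mulr0.
have xiK : (\sum_i \int[mu]_f sqint Q (xi i f) < K%:E)%E.
  rewrite big_sumType/=.
  have hM : (\sum_(p : 'I_k * 'I_k) \int[mu]_f sqint Q (fun x => M p.1 p.2 x - (p.1 == p.2)%:R)%R
      <= ((k%:R * k%:R) * k.+1%:R ^+ 2)%:E)%E.
    apply: (@le_trans _ _ (\sum_(p : 'I_k * 'I_k) (k.+1%:R ^+ 2)%:E)%E); last first.
      by rewrite sumEFin sumr_const card_prod card_ord lee_fin -natrM mulr_natl.
    apply: lee_sum => p _.
    have sqM : (sqint Q (fun x => M p.1 p.2 x - (p.1 == p.2)%:R)%R <= (k.+1%:R ^+ 2)%:E)%E.
      apply: integral_le_cst.
      - by apply: measurable_sqr; exact: measurable_funB.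
      - by move=> x; rewrite lee_fin sqr_ge0.
      - move=> x; rewrite lee_fin -[leLHS](real_normK (num_real _)).
        rewrite ler_pXn2r ?nnegrE//; apply: le_trans (ler_normB _ _) _.
        by rewrite mulrSr lerD ?Mle// ger0_norm ?ler0n// lern1 leq_b1.
    by apply: integral_le_cst => // f; exact: sqint_ge0.
  have hB : (\sum_j \int[mu]_f sqint Q (fun x => s * B j f x)%R <= k%:R%:E)%E.
    have Ek : 0 <= E^-1 * k%:R by rewrite mulr_ge0// invr_ge0 ltW.
    have mQB j : measurable_fun setT (fun f => sqint Q (B j f)).
      exact: measurable_sqint_param.
    apply: (@le_trans _ _ (\int[mu]_f ((E^-1 * k%:R)%:E * sqint nu (g f)))%E); last first.
      rewrite ge0_integralZl//; first last.
      - by move=> f _; exact: sqint_ge0.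
      - exact: (measurable_sqint_param nu measurable_residual).
      rewrite -[leRHS](_ : (E^-1 * k%:R)%:E * E%:E = _)%E; last first.
        by rewrite -EFinM; congr EFin; field; rewrite gt_eqF.
      by rewrite lee_wpmul2l// ?lee_fin// ltW.
    rewrite -ge0_integral_sum//; first last.
    - by move=> j f _; exact: sqint_ge0.
    - by move=> j; apply: measurable_sqint_param; exact: measurable_funM.
    apply: ge0_le_integral => //.
    - by move=> f _; apply: sume_ge0 => j _; exact: sqint_ge0.
    - apply: emeasurable_sum => j; apply: measurable_sqint_param.
      exact: measurable_funM.
    - by apply: measurable_funeM; exact: (measurable_sqint_param nu measurable_residual).
    - move=> f _; under eq_bigr do rewrite sqintZ// s2.
      rewrite -ge0_sume_distrr => [|j _]; last exact: sqint_ge0.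
      by rewrite EFinM -muleA lee_wpmul2l// lee_fin invr_ge0 ltW.
  apply: le_lt_trans (leeD hM hB) _; rewrite -EFinD lte_fin /K.
  have : (0 : R) <= k%:R by [].
  by rewrite mulrSr; move: (k%:R : R) => t t0; nra.
have [xs [xsD hxs]] := greedy_points mxi ixi xi0 xiK mD0 QD0 N.
(* Dividing the accumulated bound [N K] by [N^2] leaves [K / N = 1/4], both for [G] and, in units of
   [E], for [beta]. *)
have NK : N%:R = 4 * K by rewrite /N /K natrM natrX.
have K0 : 0 < K by rewrite exprn_gt0.
have N0 : 0 < N%:R :> R by rewrite NK mulr_gt0.
move: hxs; rewrite big_sumType/= => hxs.
pose G : 'M[R]_k := \matrix_(i, j) (N%:R^-1 * \sum_(l < N) M i j (xs l)).
have hG : \sum_i \sum_j (G i j - (i == j)%:R) ^+ 2 <= 4^-1.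
  have h1 : (\sum_(p : 'I_k * 'I_k) sqint mu
      (fun f => \sum_(l < N) (M p.1 p.2 (xs l) - (p.1 == p.2)%:R))%R <= (N%:R * K)%:E)%E.
    apply: le_trans hxs; rewrite leeDl//.
    by apply: sume_ge0 => j _; exact: sqint_ge0.
  have h2 (c : R) : sqint mu (fun=> c) = (c ^+ 2)%:E.
    by rewrite /sqint integral_cst// [X in (_ * X)%E]probability_setT mule1.
  move: h1; under eq_bigr do rewrite h2.
  rewrite sumEFin lee_fin pair_big/= => h1.
  have h3 (p : 'I_k * 'I_k) : G p.1 p.2 - (p.1 == p.2)%:R =
      N%:R^-1 * \sum_(l < N) (M p.1 p.2 (xs l) - (p.1 == p.2)%:R).
    rewrite sumrB mulrBr mxE; congr (_ - _).
    by rewrite sumr_const card_ord -[X in _ * X]mulr_natl mulrA mulVf ?mul1r// gt_eqF.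
  under eq_bigr do rewrite h3 exprMn.
  rewrite -mulr_sumr; apply: le_trans (ler_wpM2l _ h1) _; first exact: sqr_ge0.
  rewrite le_eqVlt; apply/orP; left; apply/eqP; rewrite NK; field.
  by rewrite gt_eqF.
pose beta j f := N%:R^-1 * \sum_(l < N) B j f (xs l).
have mbeta j : measurable_fun setT (beta j).
  apply: measurable_funM => //; apply: measurable_sum => l.
  exact: (measurable_sec1 _ (mB j)).
have hbeta : (\sum_j sqint mu (beta j) <= (E / 4)%:E)%E.
  have h1 : (\sum_j sqint mu (fun f => \sum_(l < N) s * B j f (xs l))%R <= (N%:R * K)%:E)%E.
    apply: le_trans hxs; rewrite leeDr//.
    by apply: sume_ge0 => j _; exact: sqint_ge0.
  have h2 j : sqint mu (fun f => \sum_(l < N) s * B j f (xs l)) =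
      ((E^-1 * N%:R ^+ 2)%:E * sqint mu (beta j))%E.
    rewrite -s2 -exprMn -sqintZ//; congr sqint; apply/funext => f.
    by rewrite /beta -mulr_sumr -mulrA (mulrA N%:R) mulfV ?mul1r// gt_eqF.
  move: h1; under eq_bigr do rewrite h2.
  rewrite -ge0_sume_distrr => [h1|j _]; last exact: sqint_ge0.
  have EN : 0 < E^-1 * N%:R ^+ 2 by rewrite mulr_gt0 ?invr_gt0 ?exprn_gt0.
  rewrite -(@lee_pmul2l _ (E^-1 * N%:R ^+ 2)%:E)// ?lte_fin//.
  apply: le_trans h1 _; rewrite -EFinM lee_fin NK le_eqVlt; apply/orP; left; apply/eqP.
  by field; rewrite gt_eqF.
have uG := near_identity_unitmx hG.
pose c f l := ip nu (X f) (e l).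
pose y f : 'rV[R]_k := (\row_j beta j f) *m invmx G.
(* Weighted least squares: the empirical moments of the data against the [e i] are multiplied by the
   inverse empirical Gram matrix. *)
exists xs, (fun l x => \sum_j (\sum_i N%:R^-1 * (e i (xs l) / w (xs l)) * invmx G i j) * e j x).
split => [l|l|]; first by case: (xsD l).
  by apply: measurable_sum => j; exact: measurable_funM.
have yE f x : X f x - \sum_(l < N) X f (xs l) *
      (\sum_j (\sum_i N%:R^-1 * (e i (xs l) / w (xs l)) * invmx G i j) * e j x) =
    g f x + \sum_j (- y f 0 j) * e j x.
  pose v : 'rV[R]_k := \row_i (N%:R^-1 * \sum_(l < N) X f (xs l) * (e i (xs l) / w (xs l))).
  have -> : \sum_(l < N) X f (xs l) *
      (\sum_j (\sum_i N%:R^-1 * (e i (xs l) / w (xs l)) * invmx G i j) * e j x) =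
      \sum_j (v *m invmx G) 0 j * e j x.
    under eq_bigr do rewrite mulr_sumr.
    rewrite exchange_big/=; apply: eq_bigr => j _.
    under eq_bigr do rewrite mulrA; rewrite -mulr_suml; congr (_ * _).
    under eq_bigr do rewrite mulr_sumr.
    rewrite exchange_big/= mxE; apply: eq_bigr => i _.
    rewrite mxE mulr_sumr mulr_suml; apply: eq_bigr => l _; ring.
  (* Split [X f] at the sample points into its residual and its projection. After multiplication by
     [invmx G] the projection is reproduced exactly, and only the [beta] part is an error. *)
  have -> : v = (\row_j beta j f) + (\row_j c f j) *m G.
    apply/rowP => i; rewrite !mxE; under [X in _ + X]eq_bigr do rewrite !mxE.
    under [X in _ + X]eq_bigr do rewrite mulrCA mulr_sumr.
    rewrite -mulr_sumr exchange_big/= -mulrDr -big_split/=; congr (_ * _).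
    apply: eq_bigr => l _; rewrite /B /M /g /residual mulrBl mulrBl.
    rewrite -[RHS]addrA -[LHS]addr0 mulrA; congr (_ + _).
    rewrite mulr_suml mulr_suml addrC -sumrB big1// => j _; rewrite /c; ring.
  rewrite mulmxDl mulmxK// /g /residual -/(y f) -[RHS]addrA; congr (_ + _).
  rewrite -!sumrN -big_split/=; apply: eq_bigr => j _.
  by rewrite mxE [X in _ + X]mxE /c; ring.
have hy f : (sqint nu (fun x => \sum_j (- y f 0 j) * e j x)%R
    <= 4%:E * \sum_j (beta j f ^+ 2)%:E)%E.
  rewrite sqint_comb// sumEFin -EFinM lee_fin.
  under eq_bigr do rewrite sqrrN.
  apply: le_trans (near_identity_bound hG _) _; rewrite /y mulmxKV//.
  by under eq_bigr do rewrite mxE.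
apply: (@le_trans _ _ (\int[mu]_f (2%:E * sqint nu (g f) + 8%:E * \sum_j (beta j f ^+ 2)%:E))%E).
  apply: ge0_le_integral => //.
  - by move=> f _; exact: sqint_ge0.
  - apply: measurable_sqint_param; apply: measurable_funB => //.
    apply: measurable_sum => l; apply: measurable_funM.
      exact: (measurableT_comp (measurable_sec1 (xs l) mX)).
    by apply: measurable_sum => j; apply: measurable_funM => //; exact: measurableT_comp.
  - apply: emeasurable_funD; apply: measurable_funeM.
      exact: (measurable_sqint_param nu measurable_residual).
    by apply: emeasurable_sum => j; exact: measurable_sqr.
  - move=> f _.
    rewrite (_ : (fun x => _) = (fun x => g f x + \sum_j (- y f 0 j) * e j x)); last first.
      by apply/funext => x; rewrite yE.
    apply: le_trans (sqintD_le _ _ _) _.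
    + by case: (L2_residual Le (LX f)).
    + by apply: measurable_sum => j; exact: measurable_funM.
    rewrite leeD2l// (_ : 8%:E = 2%:E * 4%:E)%E; last by rewrite -EFinM; congr EFin; ring.
    by rewrite -muleA lee_wpmul2l.
rewrite ge0_integralD//; first last.
- apply: measurable_funeM; apply: emeasurable_sum => j; exact: measurable_sqr.
- move=> f _; rewrite mule_ge0//; apply: sume_ge0 => j _; rewrite lee_fin sqr_ge0//.
- by apply: measurable_funeM; exact: (measurable_sqint_param nu measurable_residual).
- by move=> f _; rewrite mule_ge0// sqint_ge0.
rewrite !ge0_integralZl//; first last.
- by move=> f _; exact: sqint_ge0.
- exact: (measurable_sqint_param nu measurable_residual).
- by move=> f _; apply: sume_ge0 => j _; rewrite lee_fin sqr_ge0.
- by apply: emeasurable_sum => j; exact: measurable_sqr.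
rewrite ge0_integral_sum//; first last.
- by move=> j f _; rewrite lee_fin sqr_ge0.
- by move=> j; exact: measurable_sqr.
have -> : (4 * E)%:E = (2%:E * E%:E + 8%:E * (E / 4)%:E)%E.
  by rewrite -!EFinM -EFinD; congr EFin; field.
by rewrite leeD// lee_wpmul2l// ltW.
Qed.

End SampledLeastSquares.

(** The orthogonal projection onto the square integrable part of the span is at least as good as the
    given approximation, so [E] bounds its residual as well, and this residual is what sampling
    needs. *)
Lemma finite_rank_sampling dF (F : measurableType dF) d (T : measurableType d) (R : realType)
    (mu : probability F R) (nu : probability T R) (X : F -> T -> R)
    (n : nat) (Y : 'I_n -> F -> R) (a : 'I_n -> T -> R) (D : set T) (E : R) :
  measurable_fun setT (fun p : F * T => X p.1 p.2) -> (forall f, L2 nu (X f)) ->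
  (forall i, measurable_fun setT (Y i)) -> (forall i, measurable_fun setT (a i)) ->
  measurable D -> nu D = 1%E -> 0 < E ->
  (\int[mu]_f sqint nu (fun x => X f x - \sum_i Y i f * a i x)%R < E%:E)%E ->
  exists (N : nat) (xs : nat -> T) (b : nat -> T -> R),
  [/\ (N <= 4 * n.+1 ^ 4)%N /\ (n = 0 -> N = 0)%N,
      forall i, (i < N)%N -> D (xs i), forall i, measurable_fun setT (b i) &
   (\int[mu]_f sqint nu (fun x => X f x - \sum_(i < N) X f (xs i) * b i x)%R
     <= (4 * E)%:E)%E].
Proof.
move=> mX LX mY ma mD nuD E0 hE.
have [k [A [kn [LA oA] rA]]] := maximal_orthonormal nu a.
pose e (j : 'I_k) x := \sum_i A j i * a i x.
have Le j : L2 nu (e j) by exact: LA.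
have oe i j : ip nu (e i) (e j) = (i == j)%:R by exact: oA.
have mres : measurable_fun setT (fun p : F * T => residual nu e (X p.1) p.2).
  exact: (@measurable_residual _ F _ T R nu X mX k e Le).
have hres : (\int[mu]_f sqint nu (residual nu e (X f)) < E%:E)%E.
  apply: le_lt_trans hE; apply: ge0_le_integral => //.
  - by move=> f _; exact: sqint_ge0.
  - exact: (measurable_sqint_param nu mres).
  - apply: measurable_sqint_param; apply: measurable_funB => //.
    by apply: measurable_sum => i; apply: measurable_funM; exact: measurableT_comp.
  - move=> f _; apply: residual_optimal => //.
      by apply: measurable_sum => i; exact: measurable_funM.
    exact: (rA (fun i => Y i f)).
have [k0|k0] := posnP k; last first.
  have [xs [b [xsD mb hb]]] := christoffel_sampling mX LX Le oe k0 mD nuD E0 hres.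
  exists (4 * k.+1 ^ 4)%N, xs, b; split => //; split.
    by rewrite leq_mul2l/= leq_exp2r.
  by move=> n0; move: kn; rewrite n0 leqn0 => /eqP k0'; rewrite k0' in k0.
(* For [k = 0] the projection is zero and [X f] is its own residual, so no sample is taken; [x0]
   only fills the sequence. *)
have /set0P[x0 _] : D != set0.
  by apply/eqP => D0; move: nuD; rewrite D0 measure0 => /eqP; rewrite eq_sym onee_eq0.
exists 0%N, (fun=> x0), (fun _ _ => 0); split => //.
apply: (@le_trans _ _ E%:E); last by rewrite lee_fin; lra.
apply: le_trans (ltW hres); rewrite le_eqVlt; apply/orP; left; apply/eqP.
apply: eq_integral => f _; congr sqint; apply/funext => x.
rewrite big_ord0 subr0 /residual big1 ?subr0// => j _.
by have := ltn_ord j; rewrite {2}k0.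
Qed.

(** * Laws determined by trigonometric moments *)

Section SteepPolynomial.
Variable R : realType.
Implicit Types x u : R.

Lemma bernoulli_sub x n : 0 <= x <= 1 -> 1 - n%:R * x <= (1 - x) ^+ n.
Proof.
move=> /andP[x0 x1]; elim: n => [|n ih]; first by rewrite mul0r subr0 expr0.
rewrite exprS; apply: le_trans (ler_wpM2l _ ih); last by rewrite subr_ge0.
have : 0 <= n%:R * x ^+ 2 by rewrite mulr_ge0 ?sqr_ge0.
by rewrite mulrSr; nra.
Qed.

Lemma bernoulli_add x n : 0 <= x -> 1 + n%:R * x <= (1 + x) ^+ n.
Proof.
move=> x0; elim: n => [|n ih]; first by rewrite mul0r addr0 expr0.
rewrite exprS; apply: le_trans (ler_wpM2l _ ih); last by rewrite addr_ge0.
have : 0 <= n%:R * x ^+ 2 by rewrite mulr_ge0 ?sqr_ge0.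
by rewrite mulrSr; nra.
Qed.

(** Bernoulli's inequality for [1 + x], combined with [(1 - x)^n (1 + x)^n <= 1]. *)
Lemma expr_sub_le x n : 0 <= x <= 1 -> (1 - x) ^+ n <= (1 + n%:R * x)^-1.
Proof.
move=> /andP[x0 x1].
have p : 0 < 1 + n%:R * x by rewrite ltr_pwDl// mulr_ge0.
rewrite -[leRHS]mul1r ler_pdivlMr//.
apply: (@le_trans _ _ ((1 - x) ^+ n * (1 + x) ^+ n)).
  by rewrite ler_wpM2l ?exprn_ge0 ?subr_ge0// bernoulli_add.
rewrite -exprMn exprn_ile1//; nra.
Qed.

(** With [q = sqrt z], write [n z^n = (n q^n) q^n]. The first factor is bounded because
    [n q^n <= 1 + q + ... + q^(n-1)]; the second tends to 0. *)
Lemma cvg_natmul_expr (z : R) : 0 <= z < 1 -> (n%:R * z ^+ n) @[n --> \oo] --> (0 : R).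
Proof.
move=> /andP[z0 z1]; pose q := Num.sqrt z.
have q0 : 0 <= q by exact: sqrtr_ge0.
have q1 : q < 1 by rewrite -sqrtr1 ltr_sqrt.
have qz : z = q * q by rewrite -expr2 sqr_sqrtr.
have q1' : 0 < 1 - q by rewrite subr_gt0.
have nq n : n%:R * q ^+ n <= (1 - q)^-1.
  rewrite -[leRHS]mul1r ler_pdivlMr//.
  suff H : n%:R * q ^+ n * (1 - q) <= 1 - q ^+ n.
    by apply: le_trans H _; rewrite gerBl exprn_ge0.
  elim: n => [|n ih]; first by rewrite !mul0r expr0 subrr.
  have qn : 0 <= q ^+ n by rewrite exprn_ge0.
  have : q * (n%:R * q ^+ n * (1 - q)) <= q * (1 - q ^+ n) by rewrite ler_wpM2l.
  have qn1 : q ^+ n <= 1 by rewrite exprn_ile1// ltW.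
  have : 0 <= (1 - q) * (1 - q * q ^+ n) by rewrite mulr_ge0 ?subr_ge0 ?mulr_ile1// ltW.
  rewrite mulrSr exprS; lra.
have qn0 : (q ^+ n) @[n --> \oo] --> (0 : R).
  by apply: cvg_expr; rewrite ger0_norm.
apply: (squeeze_cvgr (f := fun=> 0) (h := fun n => (1 - q)^-1 * q ^+ n)).
- apply: nearW => n; rewrite mulr_ge0 ?exprn_ge0//=.
  by rewrite qz exprMn mulrA ler_wpM2r ?exprn_ge0.
- exact: cvg_cst.
- by rewrite -[X in _ --> X](mulr0 (1 - q)^-1); apply: cvgMr.
Qed.

(* The factor [n] in the exponent makes the limit [0] also at [u = 1/2]. *)
Lemma steep_polynomial_cvg u : 0 <= u <= 1 ->
  ((1 - u ^+ n) ^+ (n * 2 ^ n)) @[n --> \oo] --> ((u < 2^-1)%R%:R : R).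
Proof.
move=> /andP[u0 u1].
have un n : 0 <= u ^+ n <= 1 by rewrite exprn_ge0// exprn_ile1.
have E n : (n * 2 ^ n)%:R * u ^+ n = n%:R * (2 * u) ^+ n.
  by rewrite natrM natrX exprMn mulrA.
have [uh|uh] := ltP u 2^-1.
  apply: (squeeze_cvgr (f := fun n => 1 - n%:R * (2 * u) ^+ n) (h := fun=> 1)).
  - apply: nearW => n; rewrite -E bernoulli_sub//=.
    have /andP[a b] := un n.
    by rewrite exprn_ile1// ?subr_ge0// gerBl.
  - rewrite -[X in _ --> X](subr0 1); apply: cvgB; first exact: cvg_cst.
    by apply: cvg_natmul_expr; lra.
  - exact: cvg_cst.
apply: (squeeze_cvgr (f := fun=> 0) (h := fun n => n.+1%:R^-1)).
- apply: nearW => n; rewrite exprn_ge0 ?subr_ge0//=; last by case/andP: (un n).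
  apply: le_trans (expr_sub_le _ (un n)) _.
  rewrite E lef_pV2 ?posrE//; last by rewrite ltr_pwDl// mulr_ge0// exprn_ge0//; lra.
  rewrite mulrSr addrC lerD2l ler_peMr// exprn_ege1//; lra.
- exact: cvg_cst.
- exact: cvg_harmonic.
Qed.

End SteepPolynomial.

Section EqualLaws.
Context d (T : measurableType d) (R : realType) (mu : probability T R).
Context d' (U : measurableType d') (f g : T -> U).
Hypothesis mf : measurable_fun setT f.
Hypothesis mg : measurable_fun setT g.
Hypothesis fg : forall B, measurable B -> mu (f @^-1` B) = mu (g @^-1` B).

Let X : {RV mu >-> U} := HB.pack f (isMeasurableFun.Build _ _ _ _ f mf).
Let Y : {RV mu >-> U} := HB.pack g (isMeasurableFun.Build _ _ _ _ g mg).

Lemma equal_law_integral (h : U -> \bar R) :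
  measurable_fun setT h -> mu.-integrable setT (h \o f) -> mu.-integrable setT (h \o g) ->
  (\int[mu]_x h (f x) = \int[mu]_x h (g x))%E.
Proof.
move=> mh hf hg.
rewrite -(integral_distribution (X := X))// -(integral_distribution (X := Y))//.
by apply: eq_measure_integral => B mB _; exact: fg.
Qed.

Lemma equal_law_ge0_integral (h : U -> \bar R) :
  measurable_fun setT h -> (forall y, 0 <= h y)%E ->
  (\int[mu]_x h (f x) = \int[mu]_x h (g x))%E.
Proof.
move=> mh h0.
rewrite -(ge0_integral_distribution X)// -(ge0_integral_distribution Y)//.
by apply: eq_measure_integral => B mB _; exact: fg.
Qed.

End EqualLaws.

Section TrigonometricMatching.
Context d (T : measurableType d) (R : realType) (mu : probability T R).
Variables (N : nat) (W W' : 'I_N -> T -> R).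
Hypothesis mW : forall i, measurable_fun setT (W i).
Hypothesis mW' : forall i, measurable_fun setT (W' i).
Hypothesis lawE : forall (t : 'I_N -> R) (B : set R), measurable B ->
  mu ((fun x => \sum_i t i * W i x) @^-1` B) = mu ((fun x => \sum_i t i * W' i x) @^-1` B).

Let ang (V : 'I_N -> T -> R) (th : R) (t : 'I_N -> R) x := th + \sum_i t i * V i x.

(** The free phase [th] covers sines too, so this says that the measures with densities [H] and [H']
    have images under [W] and [W'] with the same Fourier transform. Values in [[0, 1]] provide the
    domination needed for limits. *)
Definition trig_matched (H H' : T -> R) :=
  [/\ measurable_fun setT H, measurable_fun setT H',
      forall x, 0 <= H x <= 1, forall x, 0 <= H' x <= 1 &
      forall th t, \int[mu]_x (H x * cos (ang W th t x)) =
                   \int[mu]_x (H' x * cos (ang W' th t x))].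

Let mang V th t : (forall i, measurable_fun setT (V i)) -> measurable_fun setT (ang V th t).
Proof.
move=> mV; apply: measurable_funD => //; apply: measurable_sum => i.
exact: measurable_funM.
Qed.

Let mcos V th t : (forall i, measurable_fun setT (V i)) ->
  measurable_fun setT (fun x => cos (ang V th t x)).
Proof.
move=> mV; apply: (measurableT_comp (f := @cos R)); last exact: mang.
by apply: continuous_measurable_fun; exact: continuous_cos.
Qed.

Lemma bounded_integrable (f : T -> R) : measurable_fun setT f ->
  (forall x, `|f x| <= 1) -> mu.-integrable setT (EFin \o f).
Proof.
move=> mf hf.
have h1 : mu.-integrable setT (EFin \o cst 1) by exact: finite_measure_integrable_cst.
apply: le_integrable h1 => //; first exact/measurable_EFinP.
by move=> x _; rewrite /= lee_fin normr1.
Qed.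

Let int_cos (V : 'I_N -> T -> R) (H : T -> R) th t : (forall i, measurable_fun setT (V i)) ->
  measurable_fun setT H -> (forall x, 0 <= H x <= 1) ->
  mu.-integrable setT (EFin \o (fun x => H x * cos (ang V th t x))).
Proof.
move=> mV mH H01; apply: bounded_integrable; first by apply: measurable_funM => //; exact: mcos.
move=> x; have /andP[h0 h1] := H01 x.
by rewrite normrM ger0_norm// mulr_ile1// cos_max.
Qed.

(** The assumption on linear marginals enters here: with weight 1 the integrand depends only on the
    single variable [sum_i t i * W i]. *)
Lemma trig_matched1 : trig_matched (fun=> 1) (fun=> 1).
Proof.
split=> [||x|x|th t]; [by []|by []|by rewrite ler01 lexx|by rewrite ler01 lexx|].
under eq_Rintegral do rewrite mul1r.
under [RHS]eq_Rintegral do rewrite mul1r.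
have mS (V : 'I_N -> T -> R) : (forall i, measurable_fun setT (V i)) ->
    measurable_fun setT (fun x => \sum_i t i * V i x).
  by move=> mV; apply: measurable_sum => i; exact: measurable_funM.
pose h (y : R) := (cos (th + y))%:E.
have mh : measurable_fun setT h.
  apply/measurable_EFinP; apply: (measurableT_comp (f := @cos R)).
    by apply: continuous_measurable_fun; exact: continuous_cos.
  exact: measurable_funD.
rewrite /Rintegral; congr fine.
apply: (equal_law_integral (mS _ mW) (mS _ mW') (lawE t) mh).
  by apply: bounded_integrable; [exact: mcos|move=> x; exact: cos_max].
by apply: bounded_integrable; [exact: mcos|move=> x; exact: cos_max].
Qed.

Lemma Rintegral_bounded_cvg (f_ : nat -> T -> R) (f : T -> R) :
  (forall n, measurable_fun setT (f_ n)) -> measurable_fun setT f ->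
  (forall n x, `|f_ n x| <= 1) -> (forall x, `|f x| <= 1) ->
  (forall x, (f_ n x) @[n --> \oo] --> f x) ->
  (\int[mu]_x f_ n x) @[n --> \oo] --> \int[mu]_x f x.
Proof.
move=> mf_ mf f_1 f1 f_f.
have i1 : mu.-integrable setT (EFin \o cst 1) by exact: finite_measure_integrable_cst.
have [] := @dominated_convergence _ T R mu setT measurableT
    (fun n => EFin \o f_ n) (EFin \o f) (EFin \o cst 1).
- by move=> n; exact/measurable_EFinP.
- exact/measurable_EFinP.
- by apply: aeW => x _ /=; apply: cvg_EFin => //; [exact: nearW|exact: f_f].
- exact: i1.
- by apply: aeW => x n _ /=; rewrite lee_fin.
move=> _ _ h; apply: fine_cvg.
by rewrite fineK//; apply: integrable_fin_num => //; exact: bounded_integrable.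
Qed.

(* This class is closed under products, complements and pointwise limits, which is
   how it grows from [(1 + cos) / 2] to the indicators of boxes. *)
Definition trig_multiplier (u u' : T -> R) :=
  [/\ measurable_fun setT u, measurable_fun setT u',
      forall x, 0 <= u x <= 1, forall x, 0 <= u' x <= 1 &
      forall H H', trig_matched H H' ->
        trig_matched (fun x => H x * u x) (fun x => H' x * u' x)].

Lemma unit_mul (a b : R) : 0 <= a <= 1 -> 0 <= b <= 1 -> 0 <= a * b <= 1.
Proof. by move=> /andP[a0 a1] /andP[b0 b1]; rewrite mulr_ge0// mulr_ile1. Qed.

Lemma trig_multiplier1 : trig_multiplier (fun=> 1) (fun=> 1).
Proof.
split=> [||x|x|H H' HH]; [by []|by []|by rewrite ler01 lexx|by rewrite ler01 lexx|].
by under eq_fun do rewrite mulr1; under [X in trig_matched _ X]eq_fun do rewrite mulr1.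
Qed.

Lemma trig_multiplierM u u' v v' : trig_multiplier u u' -> trig_multiplier v v' ->
  trig_multiplier (fun x => u x * v x) (fun x => u' x * v' x).
Proof.
move=> [mu_ mu' u01 u01' uH] [mv mv' v01 v01' vH]; split.
- exact: measurable_funM.
- exact: measurable_funM.
- by move=> x; exact: unit_mul.
- by move=> x; exact: unit_mul.
- move=> H H' HH; have := vH _ _ (uH _ _ HH).
  by under eq_fun do rewrite -mulrA; under [X in trig_matched _ X]eq_fun do rewrite -mulrA.
Qed.

Lemma trig_multiplierX u u' n : trig_multiplier u u' ->
  trig_multiplier (fun x => u x ^+ n) (fun x => u' x ^+ n).
Proof.
move=> uu; elim: n => [|n ih]; first exact: trig_multiplier1.
under eq_fun do rewrite exprS; under [X in trig_multiplier _ X]eq_fun do rewrite exprS.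
exact: trig_multiplierM.
Qed.

Lemma unit_onem (a : R) : 0 <= a <= 1 -> 0 <= 1 - a <= 1.
Proof. by move=> /andP[a0 a1]; rewrite subr_ge0 a1 gerBl. Qed.

Lemma trig_multiplier_onem u u' : trig_multiplier u u' ->
  trig_multiplier (fun x => 1 - u x) (fun x => 1 - u' x).
Proof.
move=> [mu_ mu' u01 u01' uH]; split.
- exact: measurable_funB.
- exact: measurable_funB.
- by move=> x; exact: unit_onem.
- by move=> x; exact: unit_onem.
- move=> H H' HH; have := uH _ _ HH; case: (HH) => mH mH' H01 H01' HE [mG mG' G01 G01' GE].
  split.
  + by apply: measurable_funM => //; exact: measurable_funB.
  + by apply: measurable_funM => //; exact: measurable_funB.
  + by move=> x; apply: unit_mul => //; exact: unit_onem.
  + by move=> x; apply: unit_mul => //; exact: unit_onem.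
  + move=> th t.
    under eq_Rintegral do rewrite mulrBr mulr1 mulrBl.
    under [RHS]eq_Rintegral do rewrite mulrBr mulr1 mulrBl.
    rewrite RintegralB//; try exact: int_cos.
    by rewrite RintegralB//; [rewrite HE GE|exact: int_cos|exact: int_cos].
Qed.

(** The product of two cosines is half the sum of the cosines of the sum and the difference of the
    angles, and both are again angles of the same form. *)
Lemma trig_multiplier_cos th0 t0 :
  trig_multiplier (fun x => 2^-1 * (1 + cos (ang W th0 t0 x)))
                  (fun x => 2^-1 * (1 + cos (ang W' th0 t0 x))).
Proof.
have mc (V : 'I_N -> T -> R) : (forall i, measurable_fun setT (V i)) ->
    measurable_fun setT (fun x => 2^-1 * (1 + cos (ang V th0 t0 x))).
  by move=> mV; apply: measurable_funM => //; apply: measurable_funD => //; exact: mcos.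
have c01 (y : R) : 0 <= 2^-1 * (1 + cos y) <= 1.
  by have := cos_le1 y; have := cos_geN1 y; lra.
split; [exact: mc|exact: mc|by move=> x; exact: c01|by move=> x; exact: c01|].
move=> H H' [mH mH' H01 H01' HE]; split.
- by apply: measurable_funM => //; exact: mc.
- by apply: measurable_funM => //; exact: mc.
- by move=> x; apply: unit_mul => //; exact: c01.
- by move=> x; apply: unit_mul => //; exact: c01.
move=> th t.
have expand (V : 'I_N -> T -> R) (G : T -> R) : (forall i, measurable_fun setT (V i)) ->
    measurable_fun setT G -> (forall x, 0 <= G x <= 1) ->
    \int[mu]_x (G x * (2^-1 * (1 + cos (ang V th0 t0 x))) * cos (ang V th t x)) =
    2^-1 * (\int[mu]_x (G x * cos (ang V th t x))) +
    (4^-1 * (\int[mu]_x (G x * cos (ang V (th + th0) (fun i => t i + t0 i) x))) +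
     4^-1 * (\int[mu]_x (G x * cos (ang V (th - th0) (fun i => t i - t0 i) x)))).
  move=> mV mG G01.
  have ic th' t' := int_cos th' t' mV mG G01.
  have icZ c th' t' : mu.-integrable setT (EFin \o (fun x => c * (G x * cos (ang V th' t' x)))).
    pose gg x := G x * cos (ang V th' t' x).
    rewrite (_ : _ \o _ = (fun x => c%:E * (EFin \o gg) x)%E)//.
    by apply: integrableZl => //; exact: ic.
  rewrite -!RintegralZl//.
  rewrite -[X in _ = _ + X]RintegralD// -RintegralD//; last first.
    pose g1 x := 4^-1 * (G x * cos (ang V (th + th0) (fun i => t i + t0 i) x)).
    pose g2 x := 4^-1 * (G x * cos (ang V (th - th0) (fun i => t i - t0 i) x)).
    rewrite (_ : _ \o _ = (EFin \o g1) \+ (EFin \o g2))%E//.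
    by apply: integrableD => //; exact: icZ.
  apply: eq_Rintegral => x _.
  have -> : ang V (th + th0) (fun i => t i + t0 i) x = ang V th t x + ang V th0 t0 x.
    by rewrite /ang; under eq_bigr do rewrite mulrDl; rewrite big_split/=; ring.
  have -> : ang V (th - th0) (fun i => t i - t0 i) x = ang V th t x - ang V th0 t0 x.
    by rewrite /ang; under eq_bigr do rewrite mulrBl; rewrite sumrB/=; ring.
  by rewrite cosD cosB; field.
by rewrite !expand// !HE.
Qed.

Lemma unit_cvg (u_ : nat -> R) (l : R) : (forall n, 0 <= u_ n <= 1) ->
  u_ n @[n --> \oo] --> l -> 0 <= l <= 1.
Proof.
move=> u01 ul; rewrite -(cvg_lim (@Rhausdorff R) ul).
have cu : cvgn u_ by apply/cvg_ex; exists l.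
apply/andP; split; [apply: limr_ge => //|apply: limr_le => //]; apply: nearW => n;
  by case/andP: (u01 n).
Qed.

Lemma trig_multiplier_lim (u_ u_' : nat -> T -> R) u u' :
  (forall n, trig_multiplier (u_ n) (u_' n)) ->
  (forall x, (u_ n x) @[n --> \oo] --> u x) -> (forall x, (u_' n x) @[n --> \oo] --> u' x) ->
  trig_multiplier u u'.
Proof.
move=> uu cu cu'.
have mu_ : measurable_fun setT u.
  by apply: (measurable_fun_cvg (h := u_)) => [n|x _]; [case: (uu n)|exact: cu].
have mu' : measurable_fun setT u'.
  by apply: (measurable_fun_cvg (h := u_')) => [n|x _]; [case: (uu n)|exact: cu'].
have u01 x : 0 <= u x <= 1.
  by apply: unit_cvg (cu x) => n; case: (uu n).
have u01' x : 0 <= u' x <= 1.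
  by apply: unit_cvg (cu' x) => n; case: (uu n).
split => // H H' HH; case: (HH) => mH mH' H01 H01' HE.
split; [exact: measurable_funM|exact: measurable_funM|by move=> x; exact: unit_mul|
  by move=> x; exact: unit_mul|].
move=> th t.
have bd (a b : R) : 0 <= a <= 1 -> `|a * cos b| <= 1.
  by move=> /andP[a0 a1]; rewrite normrM ger0_norm// mulr_ile1// cos_max.
have lim (V : 'I_N -> T -> R) (G : T -> R) (v_ : nat -> T -> R) (v : T -> R) :
    (forall i, measurable_fun setT (V i)) -> measurable_fun setT G ->
    (forall x, 0 <= G x <= 1) -> (forall n, measurable_fun setT (v_ n)) ->
    measurable_fun setT v -> (forall n x, 0 <= v_ n x <= 1) -> (forall x, 0 <= v x <= 1) ->
    (forall x, (v_ n x) @[n --> \oo] --> v x) ->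
    (\int[mu]_x (G x * v_ n x * cos (ang V th t x))) @[n --> \oo] -->
    \int[mu]_x (G x * v x * cos (ang V th t x)).
  move=> mV mG G01 mv_ mv v_01 v01 cv; apply: Rintegral_bounded_cvg.
  - by move=> n; apply: measurable_funM; [exact: measurable_funM|exact: mcos].
  - by apply: measurable_funM; [exact: measurable_funM|exact: mcos].
  - by move=> n x; apply: bd; exact: unit_mul.
  - by move=> x; apply: bd; exact: unit_mul.
  - by move=> x; apply: cvgMl; apply: cvgMr; exact: cv.
have h1 : (\int[mu]_x (H x * u_ n x * cos (ang W th t x))) @[n --> \oo] -->
    \int[mu]_x (H x * u x * cos (ang W th t x)).
  by apply: lim => // n; case: (uu n).
have h2 : (\int[mu]_x (H' x * u_' n x * cos (ang W' th t x))) @[n --> \oo] -->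
    \int[mu]_x (H' x * u' x * cos (ang W' th t x)).
  by apply: lim => // n; case: (uu n).
rewrite (_ : (fun n => _) = (fun n => \int[mu]_x (H' x * u_' n x * cos (ang W' th t x)))) in h1.
  exact: (cvg_unique _ h1 h2).
by apply/funext => n; case: (uu n) => _ _ _ _ /(_ _ _ HH) [].
Qed.

(** The phase [- pi / 2] turns the cosine into a sine, and [(1 + sin y) / 2] lies below [1/2]
    exactly when [sin y] is negative. The steep polynomials convert this threshold into an indicator
    in the limit. *)
Lemma trig_multiplier_half_ray j (b : R) (k : nat) :
  trig_multiplier (fun x => (sin (k.+1%:R^-1 * (W j x - b)) < 0)%R%:R)
                  (fun x => (sin (k.+1%:R^-1 * (W' j x - b)) < 0)%R%:R).
Proof.
pose th0 := - (k.+1%:R^-1 * b) - pi / 2.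
pose t0 (i : 'I_N) : R := if i == j then k.+1%:R^-1 else 0.
pose u (V : 'I_N -> T -> R) x := 2^-1 * (1 + cos (ang V th0 t0 x)).
have uE V x : u V x = 2^-1 * (1 + sin (k.+1%:R^-1 * (V j x - b))).
  rewrite /u -cosBpihalf; congr (_ * (_ + cos _)).
  rewrite /ang (bigD1 j)//= /t0 eqxx big1 => [|i /negbTE ->]; last by rewrite mul0r.
  by rewrite /th0; ring.
have u01 V x : 0 <= u V x <= 1.
  by rewrite /u; have := cos_le1 (ang V th0 t0 x); have := cos_geN1 (ang V th0 t0 x); lra.
have uh V x : (u V x < 2^-1) = (sin (k.+1%:R^-1 * (V j x - b)) < 0).
  by rewrite uE; apply/idP/idP; lra.
apply: (@trig_multiplier_lim (fun n x => (1 - u W x ^+ n) ^+ (n * 2 ^ n))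
                             (fun n x => (1 - u W' x ^+ n) ^+ (n * 2 ^ n))).
- move=> n; apply: trig_multiplierX; apply: trig_multiplier_onem; apply: trig_multiplierX.
  exact: trig_multiplier_cos.
- by move=> x; rewrite -uh; exact: steep_polynomial_cvg.
- by move=> x; rewrite -uh; exact: steep_polynomial_cvg.
Qed.

(** Stretching the period removes periodicity: once [|y| / (n+1) < pi], the sine has the sign of
    [y], so the sequence is eventually constant. *)
Lemma sin_sign_cvg (y : R) :
  ((sin (n.+1%:R^-1 * y) < 0)%R%:R : R) @[n --> \oo] --> ((y < 0)%R%:R : R).
Proof.
apply: cvg_near_cst.
have h : (n.+1%:R^-1 * `|y|) @[n --> \oo] --> (0 : R).
  rewrite -[X in _ --> X](mul0r `|y|); apply: cvgMl; exact: cvg_harmonic.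
have : \forall n \near \oo, n.+1%:R^-1 * `|y| < pi.
  exact: (cvgr_lt 0 h pi (pi_gt0 R)).
apply: filterS => n hn; congr ((_ : bool)%:R).
have n0 : 0 < n.+1%:R^-1 :> R by [].
have [y0|y0|->] := ltgtP y 0.
- have := @sin_gt0_pi R (n.+1%:R^-1 * - y).
  rewrite ltr0_norm// in hn; rewrite hn andbT mulr_gt0 ?oppr_gt0// => /(_ isT).
  by rewrite mulrN sinN oppr_gt0 => ->.
- apply/negbTE; rewrite -leNgt ltW//; apply: sin_gt0_pi.
  by rewrite gtr0_norm// in hn; rewrite hn andbT mulr_gt0.
- by rewrite mulr0 sin0 ltxx.
Qed.

Lemma trig_multiplier_ray j (b : R) :
  trig_multiplier (fun x => (W j x < b)%R%:R) (fun x => (W' j x < b)%R%:R).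
Proof.
apply: (trig_multiplier_lim (trig_multiplier_half_ray j b)) => x.
  by rewrite -subr_lt0; exact: sin_sign_cvg.
by rewrite -subr_lt0; exact: sin_sign_cvg.
Qed.

Lemma trig_multiplier_box (b : 'I_N -> R) :
  trig_multiplier (fun x => [forall j, W j x < b j]%:R) (fun x => [forall j, W' j x < b j]%:R).
Proof.
have E (V : 'I_N -> T -> R) x :
    [forall j, V j x < b j]%:R = \prod_(j <- index_enum 'I_N) (V j x < b j)%R%:R :> R.
  have [/forallP h|/forallPn[j hj]] := boolP [forall j, V j x < b j].
    by rewrite big1// => j _; rewrite h.
  by rewrite (bigD1 j)//= (negbTE hj) mul0r.
rewrite (_ : (fun x => _) = (fun x => \prod_(j <- index_enum 'I_N) (W j x < b j)%R%:R)); last first.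
  by apply/funext => x; exact: E.
rewrite [X in trig_multiplier _ X](_ : _ =
    (fun x => \prod_(j <- index_enum 'I_N) (W' j x < b j)%R%:R)); last first.
  by apply/funext => x; exact: E.
elim: (index_enum 'I_N) => [|j s ih].
  by under eq_fun do rewrite big_nil; under [X in trig_multiplier _ X]eq_fun do rewrite big_nil;
    exact: trig_multiplier1.
under eq_fun do rewrite big_cons; under [X in trig_multiplier _ X]eq_fun do rewrite big_cons.
by apply: trig_multiplierM => //; exact: trig_multiplier_ray.
Qed.

End TrigonometricMatching.

Section TupleBoxes.
Variables (R : realType) (N : nat).

Definition tuple_box (b : 'I_N -> R) : set (N.-tuple R) :=
  [set t | [forall j, tnth t j < b j]].

Lemma measurable_tuple_boxes :
  @measurable _ (N.-tuple R) = <<s range tuple_box >>.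
Proof.
apply/seteqP; split; last first.
  apply: smallest_sub; first exact: sigma_algebra_measurable.
  move=> _ [b _ <-].
  rewrite (_ : tuple_box b = \big[setI/setT]_(j < N) ((@tnth N R)^~ j @^-1` `]-oo, b j[)).
    apply: bigsetI_measurable => j _; rewrite -[X in measurable X]setTI.
    by apply: measurable_tnth.
  rewrite -bigcap_seq; apply/seteqP; split => t /=.
    by move=> /forallP h j _ /=; rewrite in_itv/= h.
  move=> h; apply/forallP => j; have := h j.
  by rewrite /= mem_index_enum in_itv/=; exact.
have hsub : forall j (A : set R), measurable A ->
    (<<s range tuple_box >>) ((@tnth N R)^~ j @^-1` A).
  move=> j.
  pose SA : set (set R) := [set A | (<<s range tuple_box >>) ((@tnth N R)^~ j @^-1` A)].
  suff : (@RGenInftyO.G R).-sigma.-measurable `<=` SA.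
    by rewrite -RGenInftyO.measurableE => h A mA; exact: h.
  apply: smallest_sub.
    split.
    - by rewrite /SA/= preimage_set0; exact: sigma_algebra0.
    - by move=> A hA; rewrite /SA/= setTD preimage_setC -setTD; exact: sigma_algebraCD.
    - by move=> F hF; rewrite /SA/= preimage_bigcup; exact: sigma_algebra_bigcup.
  move=> _ [c ->]; rewrite /SA/=.
  (* A condition on the coordinate [j] alone is a union of boxes whose other bounds grow with
     [n]. *)
  rewrite (_ : _ @^-1` _ = \bigcup_n tuple_box (fun i => if i == j then c else n%:R)).
    by apply: sigma_algebra_bigcup => n; apply: sub_sigma_algebra; eexists.
  apply/seteqP; split => t /=.
    rewrite in_itv/= => tc.
    pose M := \sum_(i < N) `|tnth t i|.
    exists (Num.truncn M).+1 => //; apply/forallP => i; case: eqP => [->//|_].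
    apply: le_lt_trans (truncnS_gt M).
    by rewrite /M (bigD1 i)//= ler_wpDr ?ler_norm// sumr_ge0.
  by move=> [n _ /forallP /(_ j)]; rewrite eqxx in_itv.
apply: smallest_sub; first exact: smallest_sigma_algebra.
rewrite -bigcup_seq => B [j _ [A mA <-]].
by rewrite setTI; exact: hsub.
Qed.

End TupleBoxes.

(** * Joint laws from linear marginals *)

Section CramerWold.
Context d (T : measurableType d) (R : realType) (mu : probability T R).
Variables (N : nat) (W W' : 'I_N -> T -> R).
Hypothesis mW : forall i, measurable_fun setT (W i).
Hypothesis mW' : forall i, measurable_fun setT (W' i).
Hypothesis lawE : forall (t : 'I_N -> R) (B : set R), measurable B ->
  mu ((fun x => \sum_i t i * W i x) @^-1` B) = mu ((fun x => \sum_i t i * W' i x) @^-1` B).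

Let tup (V : 'I_N -> T -> R) x := [tuple V i x | i < N].

Let mtup V : (forall i, measurable_fun setT (V i)) -> measurable_fun setT (tup V).
Proof.
move=> mV; apply/measurable_fun_tnthP => i.
by rewrite (_ : _ \o _ = V i)//; apply/funext => x /=; rewrite tnth_mktuple.
Qed.

(** Boxes are closed under intersection, generate the sigma-algebra and exhaust the space, so
    agreement on boxes suffices. *)
Lemma cramer_wold (A : set (N.-tuple R)) : measurable A ->
  mu (tup W @^-1` A) = mu (tup W' @^-1` A).
Proof.
pose X : {RV mu >-> N.-tuple R} := HB.pack (tup W) (isMeasurableFun.Build _ _ _ _ _ (mtup mW)).
pose Y : {RV mu >-> N.-tuple R} := HB.pack (tup W') (isMeasurableFun.Build _ _ _ _ _ (mtup mW')).
move=> mA.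
apply: (@measure_unique _ R (N.-tuple R) (range (@tuple_box R N))
  (fun n => tuple_box (fun=> n%:R)) _ _ _ _ (distribution mu X) (distribution mu Y)) => //.
- exact: measurable_tuple_boxes.
- move=> _ _ [b _ <-] [c _ <-]; exists (fun i => Num.min (b i) (c i)) => //.
  apply/seteqP; split => t /=.
    move=> /forallP h; split; apply/forallP => j; have := h j; rewrite lt_min.
      by case/andP.
    by case/andP.
  by move=> [/forallP h1 /forallP h2]; apply/forallP => j; rewrite lt_min h1 h2.
- apply/seteqP; split => // t _.
  pose M := \sum_(i < N) `|tnth t i|.
  exists (Num.truncn M).+1 => //; apply/forallP => i.
  apply: le_lt_trans (truncnS_gt M).
  by rewrite /M (bigD1 i)//= ler_wpDr ?ler_norm// sumr_ge0.
- move=> _ [b _ <-].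
  have [mu1 mu2 u01 u01' /(_ _ _ (trig_matched1 mW mW' lawE))] :=
    trig_multiplier_box mu mW mW' b.
  (* At angle 0 the cosine is 1, and matching with the box indicators as weights is equality of the
     box probabilities. *)
  case=> _ _ _ _ /(_ 0 (fun=> 0)).
  have E (V : 'I_N -> T -> R) : measurable_fun setT (fun x => [forall j, V j x < b j]%:R : R) ->
    (forall i, measurable_fun setT (V i)) ->
    \int[mu]_x (1 * [forall j, V j x < b j]%:R * cos (0 + \sum_i 0 * V i x)) =
    fine (mu (tup V @^-1` tuple_box b)).
    move=> mVb mV; rewrite /Rintegral; congr fine.
    rewrite -(setIT (tup V @^-1` _)) -integral_indic//; last first.
      rewrite -[X in measurable X]setTI; apply: mtup => //.
      by rewrite measurable_tuple_boxes; apply: sub_sigma_algebra; eexists.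
    apply: eq_integral => x _; rewrite mul1r big1 => [|i _]; last by rewrite mul0r.
    rewrite addr0 cos0 mulr1; congr EFin; rewrite indicE; congr (_ %:R); congr nat_of_bool.
    apply/forallP/idP => [h|/set_mem /forallP h j].
      by apply/mem_set/forallP => j; rewrite tnth_mktuple.
    by have := h j; rewrite tnth_mktuple.
  rewrite !E// => /eqP; rewrite -eqe !fineK => [/eqP//||];
    apply: fin_num_measure; rewrite -[X in measurable X]setTI; apply: mtup => //;
    rewrite measurable_tuple_boxes; apply: sub_sigma_algebra; eexists; by [].
- move=> n; rewrite -ge0_fin_numE//; apply: fin_num_measure.
  by rewrite measurable_tuple_boxes; apply: sub_sigma_algebra; eexists.
Qed.

Lemma cramer_wold_integral (h : N.-tuple R -> \bar R) :
  measurable_fun setT h -> (forall y, 0 <= h y)%E ->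
  (\int[mu]_x h [tuple W i x | i < N] = \int[mu]_x h [tuple W' i x | i < N])%E.
Proof.
by move=> mh h0; apply: (equal_law_ge0_integral (mtup mW) (mtup mW') cramer_wold).
Qed.

End CramerWold.

(** * Gaussian variables *)

Section NormalSecondMoment.
Variable R : realType.
Local Notation leb := (@lebesgue_measure R).
Implicit Types s x : R.

Definition normal_moment2 s : \bar R := (\int[leb]_x (x ^+ 2 * normal_pdf 0 s x)%:E)%E.

Let nm2_ge0 s x : 0 <= x ^+ 2 * normal_pdf 0 s x.
Proof. by rewrite mulr_ge0 ?sqr_ge0 ?normal_pdf_ge0. Qed.

Let mnm2 s : measurable_fun setT (fun x => (x ^+ 2 * normal_pdf 0 s x)%:E).
Proof.
apply/measurable_EFinP; apply: measurable_funM; first exact: exprn_measurable.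
exact: measurable_normal_pdf.
Qed.

(** Substitution [x = s y]. Together with finiteness and positivity at [s = 1] it shows that the
    second moment determines [s]. *)
Lemma normal_moment2_scale s : 0 < s ->
  normal_moment2 s = ((s ^+ 2)%:E * normal_moment2 1)%E.
Proof.
move=> s0; have sn0 : s != 0 by rewrite gt_eqF.
pose F (x : R^o) : R^o := x * s.
have F'E : F^`()%classic = cst s.
  apply/funext => x; rewrite /F derive1E deriveM// derive_cst derive_id scaler0 add0r.
  by rewrite /GRing.scale/= mulr1.
rewrite /normal_moment2.
rewrite (@increasing_ge0_integration_by_substitutionT _ F (fun x => x ^+ 2 * normal_pdf 0 s x)).
- rewrite -ge0_integralZl//; first last.
  + by rewrite lee_fin sqr_ge0.
  + by move=> x _; rewrite lee_fin.
  + exact: mnm2.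
  apply: eq_integral => x _; rewrite F'E -EFinM; congr EFin.
  rewrite !fctE/= /F !normal_pdfE//.
  rewrite /normal_peak /normal_fun !subr0.
  have -> : - (x * s) ^+ 2 / (s ^+ 2 *+ 2) = - x ^+ 2 / (1 ^+ 2 *+ 2).
    by rewrite exprMn -[_ *+ 2]mulr_natl -[1 ^+ 2 *+ 2]mulr_natl; field.
  have -> : Num.sqrt (s ^+ 2 * pi *+ 2) = s * Num.sqrt (1 ^+ 2 * pi *+ 2).
    by rewrite -mulrnAr sqrtrM ?sqr_ge0// sqrtr_sqr gtr0_norm// expr1n mul1r.
  have q0 : Num.sqrt (1 ^+ 2 * pi *+ 2) != 0 :> R.
    by rewrite gt_eqF// sqrtr_gt0 pmulrn_lgt0// mulr_gt0 ?pi_gt0// exprn_gt0.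
  by rewrite exprMn; field; rewrite q0 sn0.
- by move=> x y xy; rewrite /F ltr_pM2r.
- by rewrite F'E => ?; exact: cvg_cst.
- by rewrite F'E; exact: is_cvg_cst.
- by rewrite F'E; exact: is_cvg_cst.
- by move=> x; apply: derivableM.
- by apply: gt0_cvgMlNy => //; exact: cvg_id.
- by apply: gt0_cvgMly => //; exact: cvg_id.
- move=> x; apply: cvgM; first exact: exprn_continuous.
  exact: continuous_normal_pdf.
- by move=> x.
Qed.

(** Finiteness: [exp(-x^2/2)] is the square of [exp(-x^2/4)], and [x^2 exp(-x^2/4) <= 4], so a
    multiple of the density with [s = sqrt 2] dominates. Positivity: the density is bounded below on
    [[1, 2]]. *)
Lemma normal_moment2_1 : exists2 k : R, 0 < k & normal_moment2 1 = k%:E.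
Proof.
have fin : (normal_moment2 1 < +oo)%E.
  pose r : R := Num.sqrt 2.
  have r0 : 0 < r by rewrite sqrtr_gt0.
  have r2 : r ^+ 2 = 2 by rewrite sqr_sqrtr.
  pose C := 4 * normal_peak 1 / normal_peak r : R.
  have pr : 0 < normal_peak r by rewrite normal_peak_gt0// gt_eqF.
  have C0 : 0 <= C by rewrite divr_ge0 ?mulr_ge0 ?normal_peak_ge0.
  apply: (@le_lt_trans _ _ (\int[leb]_x (C%:E * (normal_pdf 0 r x)%:E))%E).
    apply: ge0_le_integral => //.
    + by move=> x _; rewrite lee_fin.
    + exact: mnm2.
    + by apply: measurable_funeM; apply/measurable_EFinP; exact: measurable_normal_pdf.
    + move=> x _; rewrite -EFinM lee_fin !normal_pdfE ?gt_eqF// /C /normal_fun !subr0 r2.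
      have -> : 4 * normal_peak 1 / normal_peak r * (normal_peak r * expR (- x ^+ 2 / (2 *+ 2))) =
        4 * normal_peak 1 * expR (- x ^+ 2 / (2 *+ 2)) by field; rewrite gt_eqF.
      have -> : expR (- x ^+ 2 / (1 ^+ 2 *+ 2)) =
          expR (- x ^+ 2 / (2 *+ 2)) * expR (- x ^+ 2 / (2 *+ 2)) :> R.
        by rewrite -expRD; congr expR; rewrite expr1n; field.
      set e := expR _; have e0 : 0 < e by exact: expR_gt0.
      suff : x ^+ 2 * e <= 4.
        move=> h; have pe : 0 <= normal_peak 1 * e by rewrite mulr_ge0 ?normal_peak_ge0// ltW.
        rewrite -[leRHS]mulrA.
        rewrite (_ : x ^+ 2 * _ = x ^+ 2 * e * (normal_peak 1 * e)); last by ring.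
        by rewrite ler_wpM2r.
      have := expR_ge1Dx (x ^+ 2 / (2 *+ 2)).
      have -> : expR (x ^+ 2 / (2 *+ 2)) = e^-1.
        by rewrite /e -expRN mulNr opprK.
      have x20 := sqr_ge0 x.
      move=> h; have : (1 + x ^+ 2 / (2 *+ 2)) * e <= e^-1 * e by rewrite ler_wpM2r// ltW.
      rewrite mulVf ?gt_eqF//.
      have -> : x ^+ 2 / (2 *+ 2) = x ^+ 2 / 4 by congr (_ / _); ring.
      by nra.
  rewrite ge0_integralZl//; first last.
  - by move=> x _; rewrite lee_fin normal_pdf_ge0.
  - by apply/measurable_EFinP; exact: measurable_normal_pdf.
  by rewrite integral_normal_pdf mule1 ltry.
have pos : (0 < normal_moment2 1)%E.
  have p0 : 0 < normal_pdf 0 1 (2 : R).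
    by rewrite normal_pdfE ?oner_neq0// mulr_gt0 ?expR_gt0// normal_peak_gt0 ?oner_neq0.
  apply: (@lt_le_trans _ _ (\int[leb]_(x in `[1%R, 2%R]) (cst (normal_pdf 0 1 (2 : R))%:E) x)%E).
    have l12 : leb `[1%R, 2%R] = 1%E.
      rewrite lebesgue_measure_itv/= lte_fin ltr1n -EFinB; congr EFin; ring.
    by rewrite integral_cst// [X in (_ * X)%E]l12 mule1 lte_fin.
  apply: (@le_trans _ _ (\int[leb]_(x in `[1%R, 2%R]) (x ^+ 2 * normal_pdf 0 1 x)%:E)%E).
    apply: ge0_le_integral => //.
    - by move=> x _; rewrite lee_fin ltW.
    - apply: measurable_funTS; exact: mnm2.
    - move=> x /=; rewrite in_itv/= => /andP[x1 x2]; rewrite lee_fin.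
      apply: (@le_trans _ _ (normal_pdf 0 1 x)); last first.
        by rewrite ler_peMl ?normal_pdf_ge0// expr_ge1// (le_trans ler01).
      rewrite !normal_pdfE ?oner_neq0// ler_wpM2l ?normal_peak_ge0// /normal_fun !subr0.
      rewrite ler_expR expr1n ler_pM2r; last by rewrite invr_gt0.
      by nra.
  apply: ge0_subset_integral => //; [exact: mnm2|by move=> x _; rewrite lee_fin].
exists (fine (normal_moment2 1)); last by rewrite fineK// ge0_fin_numE// ltW.
by rewrite fine_gt0// pos fin.
Qed.

End NormalSecondMoment.

Section CenteredGaussian.
Context d (T : measurableType d) (R : realType) (P : probability T R).
Implicit Types Z : T -> R.

Definition centered_gaussian Z : Prop :=
  (exists2 s : R, 0 < s & forall B : set R, measurable B ->
     P (Z @^-1` B) = normal_prob 0 s B) \/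
  (forall B : set R, measurable B -> P (Z @^-1` B) = \d_(0 : R) B).

Let msq : measurable_fun setT (fun y : R => (y ^+ 2)%:E).
Proof. by apply/measurable_EFinP; exact: exprn_measurable. Qed.

Lemma normal_sqint Z s : measurable_fun setT Z -> 0 < s ->
  (forall B : set R, measurable B -> P (Z @^-1` B) = normal_prob 0 s B) ->
  sqint P Z = normal_moment2 s.
Proof.
move=> mZ s0 hZ.
pose X : {RV P >-> R} := HB.pack Z (isMeasurableFun.Build _ _ _ _ Z mZ).
have mpdf : measurable_fun setT (normal_pdf 0 s) by exact: measurable_normal_pdf.
have pdf1 : (\int[@lebesgue_measure R]_x (EFin \o normal_pdf 0 s) x = 1)%E.
  exact: integral_normal_pdf.
have leb_functional : @integral_functional _ R R (fun g => \int[@lebesgue_measure R]_x g x)%E.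
  by case: (measure_functional (@lebesgue_measure R)).
(* The normal law is rebuilt as a weighted probability, for which integrals of nonnegative functions
   are known in terms of the density. *)
have [Q QE] := weighted_probability leb_functional mpdf (normal_pdf_ge0 0 s) pdf1.
have := ge0_integral_distribution X msq; rewrite /sqint => <-; last first.
  by move=> y; rewrite lee_fin sqr_ge0.
transitivity (\int[Q]_y (y ^+ 2)%:E)%E.
  apply: eq_measure_integral => B mB _.
  rewrite [LHS]hZ// -(setIT B) -[RHS]integral_indic// QE//; last first.
    by apply/measurable_EFinP; exact: measurable_indic.
  rewrite /normal_prob setIT integral_mkcond; apply: eq_integral => x _.
  rewrite patchE indicE; case: ifP => _; first by rewrite mule1.
  by rewrite mule0.
rewrite QE// => [|y]; last by rewrite lee_fin sqr_ge0.
by apply: eq_integral => y _; rewrite -EFinM mulrC.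
Qed.

Lemma dirac_sqint Z : measurable_fun setT Z ->
  (forall B : set R, measurable B -> P (Z @^-1` B) = \d_(0 : R) B) -> sqint P Z = 0%E.
Proof.
move=> mZ hZ.
pose X : {RV P >-> R} := HB.pack Z (isMeasurableFun.Build _ _ _ _ Z mZ).
have := ge0_integral_distribution X msq; rewrite /sqint => <-; last first.
  by move=> y; rewrite lee_fin sqr_ge0.
transitivity (\int[\d_(0%R : R)]_y (y ^+ 2)%:E)%E.
  by apply: eq_measure_integral => B mB _; exact: hZ.
by rewrite integral_dirac// expr0n mule0.
Qed.

Lemma centered_gaussian_L2 Z : measurable_fun setT Z -> centered_gaussian Z -> L2 P Z.
Proof.
move=> mZ [[s s0 hZ]|hZ]; split => //; last by rewrite dirac_sqint.
rewrite (normal_sqint mZ s0)// normal_moment2_scale//.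
by have [k _ ->] := normal_moment2_1 R; rewrite -EFinM ltry.
Qed.

(** A centred Gaussian law is determined by its variance. The mixed case is impossible, because a
    nondegenerate law has positive second moment. *)
Lemma centered_gaussian_law Z Z' : measurable_fun setT Z -> measurable_fun setT Z' ->
  centered_gaussian Z -> centered_gaussian Z' -> sqint P Z = sqint P Z' ->
  forall B : set R, measurable B -> P (Z @^-1` B) = P (Z' @^-1` B).
Proof.
have [k k0 kE] := normal_moment2_1 R.
have nz (s : R) : 0 < s -> (normal_moment2 s == 0)%E = false.
  move=> s0; rewrite normal_moment2_scale// kE -EFinM eqe.
  by rewrite gt_eqF// mulr_gt0// exprn_gt0.
move=> mZ mZ' [[s s0 hZ]|hZ] [[s' s0' hZ']|hZ'].
- rewrite (normal_sqint mZ s0)// (normal_sqint mZ' s0')//.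
  rewrite (normal_moment2_scale s0) (normal_moment2_scale s0') kE.
  move=> [] /(mulIf (lt0r_neq0 k0)) ss B mB.
  rewrite hZ// hZ'//; congr (normal_prob _ _ _).
  by apply/eqP; rewrite -(eqrXn2 (ltn0Sn 1)) ?ltW//; apply/eqP.
- by rewrite (normal_sqint mZ s0)// (dirac_sqint mZ')// => /eqP; rewrite nz.
- by rewrite (normal_sqint mZ' s0')// (dirac_sqint mZ)// => /esym/eqP; rewrite nz.
- by move=> _ B mB; rewrite hZ// hZ'.
Qed.

(** * Optimality of linear regression for Gaussian data *)

Section Regression.
Variables (n : nat) (X : T -> R) (Y : 'I_n -> T -> R).
Hypothesis mX : measurable_fun setT X.
Hypothesis mY : forall i, measurable_fun setT (Y i).
Hypothesis gXY : forall (s : R) (t : 'I_n -> R),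
  centered_gaussian (fun x => s * X x + \sum_i t i * Y i x).

Let LX : L2 P X.
Proof.
apply: centered_gaussian_L2 => //; have := gXY 1 (fun=> 0).
congr centered_gaussian; apply/funext => x.
by rewrite mul1r big1 ?addr0// => i _; rewrite mul0r.
Qed.

Let LY i : L2 P (Y i).
Proof.
apply: centered_gaussian_L2 => //; have := gXY 0 (fun j => (j == i)%:R).
congr centered_gaussian; apply/funext => x.
rewrite mul0r add0r (bigD1 i)//= eqxx mul1r big1 ?addr0// => j /negbTE ->.
by rewrite mul0r.
Qed.

Lemma gaussian_regression_optimal (a : 'I_n -> R) (phi : n.-tuple R -> R) :
  measurable_fun setT phi ->
  (forall i, ip P (fun x => X x - \sum_j a j * Y j x) (Y i) = 0) ->
  (sqint P (fun x => X x - \sum_j a j * Y j x)%R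
     <= sqint P (fun x => X x - phi [tuple Y i x | i < n])%R)%E.
Proof.
move=> mphi hZ; set Z := (fun x => X x - _).
have LaY t : L2 P (fun x => \sum_j t j * Y j x).
  by apply: L2_sum => j; exact: L2Z.
have LZ : L2 P Z by exact: L2B.
have mZ : measurable_fun setT Z by case: LZ.
(* The vector made of [e * Z] and the data; it is compared for [e = 1] and [e = -1]. *)
pose W (e : R) (i : 'I_n.+1) x := if unlift ord0 i is Some j then Y j x else e * Z x.
have mW e i : measurable_fun setT (W e i).
  by rewrite /W; case: (unlift _ _) => [j|] //; exact: measurable_funM.
have WE e (t : 'I_n.+1 -> R) x : \sum_i t i * W e i x =
    e * t ord0 * Z x + \sum_j t (lift ord0 j) * Y j x.
  rewrite big_ord_recl /W unlift_none; congr (_ + _); first by ring.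
  by apply: eq_bigr => j _; rewrite liftK.
(* As [Z] is orthogonal to the data, the variance of a linear combination depends on [e] only
   through [e ^+ 2]. *)
have sqW e t : e ^+ 2 = 1 -> sqint P (fun x => \sum_i t i * W e i x) =
    (t ord0 ^+ 2 * ip P Z Z + ip P (fun x => \sum_j t (lift ord0 j) * Y j x)
      (fun x => \sum_j t (lift ord0 j) * Y j x))%:E.
  move=> e2; under [X in sqint P X]eq_fun do rewrite WE.
  have LcZ := L2Z (e * t ord0) LZ.
  have LU := LaY (fun j => t (lift ord0 j)).
  rewrite sqintE; last exact: L2D.
  rewrite (ipDl LcZ LU (L2D LcZ LU)) (ipDr LcZ LU LcZ) (ipDr LcZ LU LU).
  have c0 : ip P (fun x => e * t ord0 * Z x) (fun x => \sum_j t (lift ord0 j) * Y j x) = 0.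
    rewrite ipZl// ip_sumr => [|j|//]; last exact: L2Z.
    by rewrite big1 ?mulr0// => j _; rewrite ipZr// hZ mulr0.
  rewrite c0 (ipC _ _ (fun x => e * t ord0 * Z x)) c0 ipZl// ipZr// addr0 add0r.
  by congr (_ + _)%:E; rewrite mulrA -expr2 exprMn e2 mul1r.
have gW e t : centered_gaussian (fun x => \sum_i t i * W e i x).
  have := gXY (e * t ord0) (fun j => t (lift ord0 j) - e * t ord0 * a j).
  congr centered_gaussian; apply/funext => x.
  transitivity (e * t ord0 * X x +
      (\sum_j t (lift ord0 j) * Y j x - e * t ord0 * \sum_j a j * Y j x)).
    by congr (_ + _); rewrite mulr_sumr -sumrB; apply: eq_bigr => j _; ring.
  by rewrite WE /Z; ring.
have mWs e t : measurable_fun setT (fun x => \sum_i t i * W e i x).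
  by apply: measurable_sum => i; exact: measurable_funM.
have law t (B : set R) : measurable B ->
    P ((fun x => \sum_i t i * W 1 i x) @^-1` B) = P ((fun x => \sum_i t i * W (-1) i x) @^-1` B).
  move=> mB; apply: centered_gaussian_law => //.
  by rewrite !sqW ?expr1n ?sqrrN ?expr1n.
(* The regression is itself a function of the data, so [X - phi] becomes [Z + psi]. *)
pose psi (y : n.-tuple R) := \sum_j a j * tnth y j - phi y.
have mpsi : measurable_fun setT psi.
  apply: measurable_funB => //; apply: measurable_sum => j.
  by apply: measurable_funM => //; exact: measurable_tnth.
pose h (t : n.+1.-tuple R) := ((thead t + psi [tuple of behead t]) ^+ 2)%:E.
have mh : measurable_fun setT h.
  apply/measurable_EFinP; apply: measurable_funX; apply: measurable_funD.
    exact: measurable_tnth.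
  by apply: measurableT_comp => //; exact: measurable_behead.
have hW e x : h [tuple W e i x | i < n.+1] = ((e * Z x + psi [tuple Y i x | i < n]) ^+ 2)%:E.
  rewrite /h; congr ((_ + psi _) ^+ 2)%:E.
    by rewrite /thead tnth_mktuple /W unlift_none.
  apply: eq_from_tnth => j; rewrite tnth_mktuple tnth_behead tnth_mktuple.
  by rewrite /W (_ : inord j.+1 = lift ord0 j) ?liftK//; apply/val_inj; rewrite /= inordK ?ltnS.
pose V x := psi [tuple Y i x | i < n].
have mV : measurable_fun setT V.
  apply: (measurableT_comp mpsi); apply/measurable_fun_tnthP => i.
  by rewrite (_ : _ \o _ = Y i)//; apply/funext => x /=; rewrite tnth_mktuple.
have E1 : sqint P (fun x => X x - phi [tuple Y i x | i < n]) = sqint P (fun x => Z x + V x).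
  congr sqint; apply/funext => x; rewrite /Z /V /psi.
  under [X in _ + (X - _)]eq_bigr do rewrite tnth_mktuple.
  by ring.
have E2 : sqint P (fun x => Z x + V x) = sqint P (fun x => - Z x + V x).
  have h0 y : (0 <= h y)%E by rewrite lee_fin sqr_ge0.
  transitivity (\int[P]_x h [tuple W 1%R i x | i < n.+1])%E.
    by apply: eq_integral => x _; rewrite hW mul1r.
  rewrite (cramer_wold_integral (mW 1) (mW (-1)) law mh h0).
  by apply: eq_integral => x _; rewrite hW mulN1r.
(* Pointwise [(Z + V)^2 + (-Z + V)^2 = 2 Z^2 + 2 V^2], and by symmetry both terms on the left have
   the same mean. *)
have E3 : (sqint P Z + sqint P Z <=
    sqint P (fun x => Z x + V x)%R + sqint P (fun x => - Z x + V x)%R)%E.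
  have mZV : measurable_fun setT (fun x => Z x + V x) by exact: measurable_funD.
  have mNZV : measurable_fun setT (fun x => - Z x + V x).
    by apply: measurable_funD => //; exact: measurableT_comp.
  rewrite /sqint -!ge0_integralD//; try exact: measurable_sqr;
    try (by move=> x _; rewrite lee_fin sqr_ge0).
  apply: ge0_le_integral => //.
  - by move=> x _; rewrite -EFinD lee_fin addr_ge0 ?sqr_ge0.
  - by apply: emeasurable_funD; exact: measurable_sqr.
  - by apply: emeasurable_funD; exact: measurable_sqr.
  - move=> x _; rewrite -!EFinD lee_fin; have := sqr_ge0 (V x); nra.
rewrite E1; move: E3; rewrite -E2 (sqintE LZ).
have := sqint_ge0 P (fun x => Z x + V x).
case: (sqint P (fun x => Z x + V x)) => [r|_ _|//]; last by rewrite leey.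
by rewrite -!EFinD !lee_fin; lra.
Qed.

End Regression.
End CenteredGaussian.

Section NormalEquations.
Context d (T : measurableType d) (R : realType) (P : probability T R).
Variables (n : nat) (Y : 'I_n -> T -> R).
Hypothesis LY : forall i, L2 P (Y i).

Definition gram : 'M[R]_n := \matrix_(i, j) ip P (Y i) (Y j).

(** The pseudo-inverse allows linearly dependent data. It solves the equations because the
    right-hand side lies in the row space of the Gram matrix. *)
Lemma normal_equations (X : T -> R) : L2 P X ->
  let a := (\row_j ip P X (Y j)) *m pinvmx gram in
  forall i, ip P (fun x => X x - \sum_j a 0 j * Y j x) (Y i) = 0.
Proof.
move=> LX a i.
set c : 'rV[R]_n := \row_j _ in a *.
have LcY (t : 'I_n -> R) : L2 P (fun x => \sum_j t j * Y j x).
  by apply: L2_sum => j; exact: L2Z.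
have ip_sum_Y (t : 'I_n -> R) (U : T -> R) : L2 P U ->
    ip P U (fun x => \sum_j t j * Y j x) = \sum_j t j * ip P U (Y j).
  move=> LU; rewrite ip_sumr => [|j|//]; last exact: L2Z.
  by apply: eq_bigr => j _; rewrite ipZr.
(* A vector [v] in the kernel of the Gram matrix gives a combination of the [Y j] of norm zero, to
   which [X] is orthogonal. *)
have cC : (c <= gram)%MS.
  rewrite submxE; apply/eqP/rowP => k; rewrite !mxE.
  pose v j := cokermx gram j k.
  have v0 l : \sum_j v j * ip P (Y l) (Y j) = 0.
    have := congr1 (fun M : 'M[R]_n => M l k) (mulmx_coker gram).
    rewrite !mxE => h; rewrite -[RHS]h; apply: eq_bigr => j _.
    by rewrite mxE mulrC.
  have V0 : ip P (fun x => \sum_j v j * Y j x) (fun x => \sum_j v j * Y j x) = 0.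
    rewrite ip_sum_Y// big1// => j _.
    by rewrite ipC ip_sum_Y// v0 mulr0.
  have := ip_eq0_ae (LcY v) LX V0; rewrite ipC ip_sum_Y// => h.
  by rewrite -[RHS]h; apply: eq_bigr => j _; rewrite mxE mulrC.
rewrite ipBl// [X in _ - X]ipC ip_sum_Y//.
have := congr1 (fun M : 'rV[R]_n => M 0 i) (mulmxKpV cC); rewrite -/a [LHS]mxE [RHS]mxE => h.
rewrite -[X in X - _]h -sumrB big1// => j _.
have gE : gram j i = ip P (Y i) (Y j) by rewrite mxE ipC.
by rewrite gE subrr.
Qed.

End NormalEquations.

(** By Tonelli the error is an integral over [x] of one-variable regression errors. The Gram matrix
    does not depend on [x], so the coefficients are fixed linear combinations of the measurable
    functions [x |-> ip (X x) (Y j)]. *)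
Lemma gaussian_linear_optimal dF (F : measurableType dF) d (T : measurableType d) (R : realType)
    (mu : probability F R) (nu : probability T R) (X : F -> T -> R)
    (n : nat) (Y : 'I_n -> F -> R) (phi : n.-tuple R -> T -> R) :
  measurable_fun setT (fun p : F * T => X p.1 p.2) ->
  (forall i, measurable_fun setT (Y i)) ->
  measurable_fun setT (fun p : n.-tuple R * T => phi p.1 p.2) ->
  (forall x (s : R) (t : 'I_n -> R),
    centered_gaussian mu (fun f => s * X f x + \sum_i t i * Y i f)) ->
  exists2 a : 'I_n -> T -> R, forall i, measurable_fun setT (a i) &
   (\int[mu]_f sqint nu (fun x => X f x - \sum_i Y i f * a i x)%R <=
    \int[mu]_f sqint nu (fun x => X f x - phi [tuple Y i f | i < n] x)%R)%E.
Proof.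
move=> mX mY mphi gXY.
have mXx x : measurable_fun setT (fun f => X f x) by exact: (measurable_sec1 x mX).
have LX x : L2 mu (fun f => X f x).
  apply: centered_gaussian_L2 => //; have := gXY x 1 (fun=> 0).
  congr centered_gaussian; apply/funext => f.
  by rewrite mul1r big1 ?addr0// => i _; rewrite mul0r.
have LYx (x : T) i : L2 mu (Y i).
  apply: centered_gaussian_L2 => //; have := gXY x 0 (fun j => (j == i)%:R).
  congr centered_gaussian; apply/funext => f.
  rewrite mul0r add0r (bigD1 i)//= eqxx mul1r big1 ?addr0// => j /negbTE ->.
  by rewrite mul0r.
have mc j : measurable_fun setT (fun x => ip mu (fun f => X f x) (Y j)).
  apply: (measurable_Rintegral_param mu (Y := fun x f => X f x * Y j f)).
  apply: measurable_funM; last exact: measurableT_comp.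
  exact: (measurableT_comp mX (@measurable_swap _ _ T F)).
pose a i x := ((\row_j ip mu (fun f => X f x) (Y j)) *m pinvmx (gram mu Y)) 0 i.
have ma i : measurable_fun setT (a i).
  rewrite /a; under eq_fun do rewrite mxE.
  apply: measurable_sum => j; apply: measurable_funM => //.
  by under eq_fun do rewrite mxE; exact: mc.
exists a => //.
have mtup : measurable_fun setT (fun f => [tuple Y i f | i < n]).
  apply/measurable_fun_tnthP => i.
  by rewrite (_ : _ \o _ = Y i)//; apply/funext => x /=; rewrite tnth_mktuple.
have m1 : measurable_fun setT (fun p : F * T => X p.1 p.2 - \sum_i Y i p.1 * a i p.2).
  apply: measurable_funB => //; apply: measurable_sum => i.
  by apply: measurable_funM; exact: measurableT_comp.
have m2 : measurable_fun setT (fun p : F * T => X p.1 p.2 - phi [tuple Y i p.1 | i < n] p.2).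
  apply: measurable_funB => //.
  apply: (measurableT_comp mphi (g := fun p : F * T => ([tuple Y i p.1 | i < n], p.2))).
  apply: measurable_fun_pair => //; exact: (measurableT_comp mtup measurable_fst).
have tonelli (G : F -> T -> R) : measurable_fun setT (fun p : F * T => G p.1 p.2) ->
    (\int[mu]_f sqint nu (G f) = \int[nu]_x sqint mu (fun f => G f x))%E.
  move=> mG; rewrite /sqint.
  apply: (fubini_tonelli (m1 := mu) (m2 := nu) (fun p : F * T => (G p.1 p.2 ^+ 2)%:E)).
    exact: measurable_sqr.
  by move=> p; rewrite lee_fin sqr_ge0.
have msqi (G : F -> T -> R) : measurable_fun setT (fun p : F * T => G p.1 p.2) ->
    measurable_fun setT (fun x => sqint mu (fun f => G f x)).
  move=> mG; apply: (measurable_sqint_param mu (Y := fun x f => G f x)).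
  exact: (measurableT_comp mG (@measurable_swap _ _ T F)).
rewrite (tonelli _ m1) (tonelli _ m2).
apply: ge0_le_integral => //.
- by move=> x _; exact: sqint_ge0.
- exact: msqi m1.
- exact: msqi m2.
- move=> x _.
  rewrite (_ : (fun f => _) = (fun f => X f x - \sum_i a i x * Y i f)); last first.
    by apply/funext => f; congr (_ - _); apply: eq_bigr => i _; rewrite mulrC.
  apply: (@gaussian_regression_optimal _ F R mu n (X^~ x) Y _ _ _ (fun i => a i x) (phi^~ x)) => //.
    exact: (measurable_sec1 x mphi).
  exact: (normal_equations (LYx x) (LX x)).
Qed.

(** * The setting of average case approximation *)

Lemma continuous_borel_measurable (R : realType) (V : normedModType R) (L : V -> R) :
  continuous L ->
  measurable_fun (setT : set (g_sigma_algebraType (@open V)))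
    (L : g_sigma_algebraType (@open V) -> R).
Proof.
move=> /continuousP cL; apply: (measurability _ (RGenOpens.measurableE R)).
move=> _ [_ [a [b ->]] <-]; rewrite setTI.
by apply: sub_sigma_algebra; apply: cL; exact: interval_open.
Qed.

Lemma separable_enum (R : realType) (V : normedModType R) (S : set V) :
  countable S -> closure S = setT ->
  exists e : nat -> V, forall (f : V) (r : R), 0 < r -> exists k, `|f - e k| < r.
Proof.
move=> /countable_injP [g gS] dS.
pose e n := if pselect (exists2 s, S s & g s = n) is left h then s2val (cid2 h) else 0.
have eg s : S s -> e (g s) = s.
  move=> Ss; rewrite /e; case: pselect => [h|[]]; last by exists s.
  case: (cid2 h) => s' Ss' /= gs'; apply: gS => //; by apply/mem_set.
exists e => f r r0.
have : closure S f by rewrite dS.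
move=> /(_ _ (nbhsx_ballx f r r0)) [s [Ss fs]].
by exists (g s); rewrite eg//; move: fs; rewrite -ball_normE.
Qed.

(** * Joint measurability of point evaluation *)

Section CaratheodoryMeasurable.
Variables (R : realType) (V : normedModType R) (d : measure_display) (T : measurableType d).
Let F := g_sigma_algebraType (@open V).

(** Replace [f] by the first point of a dense sequence within [1/(N+1)]. The result is piecewise
    constant in [f] on countably many Borel pieces, hence jointly measurable, and it converges by
    continuity in [f]. *)
Lemma caratheodory_measurable (S : set V) (X : V -> T -> R) :
  countable S -> closure S = setT ->
  (forall f, measurable_fun setT (X f)) -> (forall x, continuous (X ^~ x)) ->
  measurable_fun setT (fun p : F * T => X p.1 p.2).
Proof.
move=> cS dS mX cX.
have [e He] := separable_enum cS dS.
have H N (f : V) : exists k, (`|f - e k| < N.+1%:R^-1) by apply: He.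
pose k N f := ex_minn (H N f).
pose U N j : set F := [set f | `|f - e j| < N.+1%:R^-1].
have mU N j : measurable (U N j).
  apply: sub_sigma_algebra.
  rewrite (_ : U N j = ball (e j) (N.+1%:R^-1 : R)); first exact: ball_open.
  by apply/seteqP; split => f; rewrite /U -ball_normE /= distrC.
(* The set of [f] for which [j] is the first admissible index. *)
pose A N j : set F := U N j `\` \big[setU/set0]_(i < j) U N i.
have mA N j : measurable (A N j).
  by apply: measurableD => //; exact: bigsetU_measurable.
have kA N f : A N (k N f) f.
  rewrite /A /k; case: ex_minnP => m hm hmin; split => //.
  rewrite -bigcup_seq => -[i _ /= hi].
  by have := hmin i hi; rewrite leqNgt ltn_ord.
have Ak N j f : A N j f -> j = k N f.
  move=> [Uj nU]; rewrite /k; case: ex_minnP => m hm hmin.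
  apply/eqP; rewrite eqn_leq (hmin j Uj) andbT leqNgt; apply/negP => mj.
  apply: nU; rewrite -bigcup_seq; exists (Ordinal mj) => //=.
  by rewrite mem_index_enum.
apply: (measurable_fun_cvg (h := fun N (p : F * T) => X (e (k N p.1)) p.2)).
  move=> N _ B mB; rewrite setTI.
  rewrite (_ : _ @^-1` B = \bigcup_j (A N j `*` (X (e j) @^-1` B))).
    apply: bigcupT_measurable => j; apply: measurableX => //.
    by rewrite -[X in measurable X]setTI; exact: mX.
  apply/seteqP; split => [[f x]/= Bx|[f x] [j _ [/= /Ak -> //]]].
  by exists (k N f) => //; split => //=; exact: kA.
move=> [f x] _ /=.
apply: (cvg_comp (fun N => e (k N f)) (X ^~ x)); last exact: cX.
apply/cvgrPdist_lt => r r0.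
near=> N.
have [+ _] := kA N f; rewrite /U/= => /lt_trans; apply.
near: N.
exact: (near_infty_natSinv_lt (PosNum r0)).
Unshelve. all: by end_near.
Qed.

End CaratheodoryMeasurable.

Lemma measurable_indicM d (T : measurableType d) (R : realType) (D : set T)
    (h : T -> R) :
  measurable D -> measurable_fun D h ->
  measurable_fun setT (fun x => \1_D x * h x).
Proof.
move=> mD mh; rewrite (_ : (fun x => _) = h \_ D).
  by apply/(measurable_restrictT _ mD).
by apply/funext => x; rewrite patchE indicE; case: ifP => _; rewrite ?mul1r ?mul0r.
Qed.

Section Setting.
Variables (R : realType) (P : app_data R) (d : nat).
Hypothesis HP : app_setting P.
Let T := d.+1.-tuple R.
Let F := g_sigma_algebraType (@open (Fsp P d)).

(* [ev] extended by zero outside the domain, where it is unconstrained. *)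
Definition ev0 (f : Fsp P d) (x : T) : R := \1_(Dom P d) x * ev P d f x.

Lemma ev0_out f x : ~ Dom P d x -> ev0 f x = 0.
Proof. by move=> nD; rewrite /ev0 indicE memNset// mul0r. Qed.

Lemma ev0_in f x : Dom P d x -> ev0 f x = ev P d f x.
Proof. by move=> Dx; rewrite /ev0 indicE mem_set// mul1r. Qed.

(** Presents [G_d] as the square integrable functions of a probability on all tuples. Since [\1_D]
    equals its square, truncating [h] to the domain does not change the norm. *)
Lemma setting_probability : exists nu : probability T R, nu (Dom P d) = 1%E /\
  forall h : T -> R, measurable_fun (Dom P d) h ->
    gnorm2 P h = sqint nu (fun x => \1_(Dom P d) x * h x).
Proof.
have [[mD _] [mrho rho0 rho1] _ _ _] := HP d.
pose w (x : T) := \1_(Dom P d) x * rho P d x.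
have mw : measurable_fun setT w by exact: measurable_indicM.
have w0 x : 0 <= w x.
  rewrite /w indicE; have [/set_mem Dx|_] := boolP (x \in Dom P d); last by rewrite mul0r.
  by rewrite mul1r rho0.
have [nu Hnu] := weighted_probability (itint_functional R d.+1) mw w0 rho1.
exists nu; split.
  rewrite -(setIT (Dom P d)) -integral_indic// Hnu//; last exact/measurable_EFinP/measurable_indic.
  rewrite -[RHS]rho1; congr itint; apply/funext => x.
  by rewrite -EFinM /w indicE; case: (_ \in _) => /=; congr EFin; ring.
move=> h mh; rewrite /sqint Hnu.
- rewrite /gnorm2; congr itint; apply/funext => x.
  by rewrite -EFinM /w indicE; case: (_ \in _) => /=; congr EFin; ring.
- by apply: measurable_sqr; exact: measurable_indicM.
- by move=> x; rewrite lee_fin sqr_ge0.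
Qed.

Lemma measurable_ev0 : measurable_fun setT (fun p : F * T => ev0 p.1 p.2).
Proof.
have [[mD _] _ [[S cS dS] _] [[mev _ _ _] cev] _] := HP d.
apply: (caratheodory_measurable cS dS) => [f|x].
  exact: measurable_indicM.
have [Dx|nDx] := pselect (Dom P d x).
  by under eq_fun do rewrite ev0_in//; exact: cev.
by under eq_fun do rewrite ev0_out//; exact: cst_continuous.
Qed.

Lemma ev_lin x : Dom P d x -> lin_functional (fun f => ev P d f x).
Proof. by have [_ _ [_ lev] _ _] := HP d => Dx a f g; exact: lev. Qed.

Lemma ev_cont x : Dom P d x -> continuous (fun f => ev P d f x).
Proof. by have [_ _ _ [_ cev] _] := HP d => Dx; exact: cev. Qed.

(** Each such combination is itself a continuous linear functional, so the assumption on [mu]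
    applies to it; outside the domain the evaluation term is the zero functional. *)
Lemma ev0_gaussian n (L : 'I_n -> Fsp P d -> R) :
  (forall i, lin_functional (L i) /\ continuous (L i)) ->
  forall x (s : R) (t : 'I_n -> R),
    centered_gaussian (mu P d) (fun f : F => s * ev0 f x + \sum_i t i * L i f).
Proof.
move=> HL x s t.
have [_ _ _ _ hG] := HP d.
have cS (V : topologicalType) (I : Type) (r : seq I) (u : I -> V -> R) :
    (forall i, continuous (u i)) -> continuous (fun f => \sum_(i <- r) u i f).
  move=> cu; elim: r => [|i r ih] f.
    by under eq_fun do rewrite big_nil; exact: cst_continuous.
  under eq_fun do rewrite big_cons; apply: cvgD; [exact: cu|exact: ih].
apply: hG.
- move=> a f g; rewrite !mulrDr mulr_sumr.
  have -> : ev0 (a *: f + g) x = a * ev0 f x + ev0 g x.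
    have [Dx|nDx] := pselect (Dom P d x); last by rewrite !ev0_out// mulr0 addr0.
    by rewrite !ev0_in// (ev_lin Dx).
  rewrite (_ : \sum_i t i * L i (a *: f + g) =
     \sum_i a * (t i * L i f) + \sum_i t i * L i g); first by ring.
  rewrite -big_split/=; apply: eq_bigr => i _; have [-> _] := HL i; ring.
- move=> f; apply: cvgD.
    apply: cvgMr; have [Dx|nDx] := pselect (Dom P d x).
      by under eq_fun do rewrite ev0_in//; rewrite ev0_in//; exact: ev_cont.
    by under eq_fun do rewrite ev0_out//; rewrite ev0_out//; exact: cvg_cst.
  by apply: cS => i g; apply: cvgMr; have [_ cL] := HL i; exact: cL.
Qed.

End Setting.

(** * Comparison of the two information classes *)

Section Transfer.
Variables (R : realType) (P : app_data R).
Hypothesis HP : app_setting P.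

Lemma in_class_std_all d (L : Fsp P d -> R) : in_class Lstd L -> in_class Lall L.
Proof. by move=> [x Dx ->]; split; [exact: ev_lin|exact: ev_cont]. Qed.

Lemma eavg_n_all_le_std n d : (eavg_n P Lall n d <= eavg_n P Lstd n d)%E.
Proof.
apply: le_ereal_inf_tmp => _ [L [phi [[HL mphi phi0] ->]]].
apply: ereal_inf_lbound; exists L, phi; split => //; split => // i.
exact: in_class_std_all.
Qed.

Lemma esqrt_lt (x : \bar R) (c : R) : (0 <= x)%E -> 0 < c ->
  (esqrt x < c%:E)%E -> (x < (c ^+ 2)%:E)%E.
Proof.
case: x => [r|//|//] r0 c0; rewrite /= !lte_fin => h.
rewrite lee_fin in r0; rewrite -(sqr_sqrtr r0) ltr_pXn2r// ?nnegrE ?sqrtr_ge0//.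
exact: ltW.
Qed.

Lemma esqrt_le (x : \bar R) (c : R) : (0 <= x)%E -> 0 <= c ->
  (x <= (c ^+ 2)%:E)%E -> (esqrt x <= c%:E)%E.
Proof.
case: x => [r|//|//] r0 c0; rewrite /= !lee_fin => h.
by rewrite -(ger0_norm c0) -sqrtr_sqr ler_wsqrtr.
Qed.

(** The strict inequality yields an actual algorithm below the level [c], since the infimum need not
    be attained. Regression and then sampling turn its squared error into at most [4 c^2]. *)
Lemma eavg_n_std_le_all n d (c : R) : 0 < c -> (eavg_n P Lall n d < c%:E)%E ->
  exists N : nat, [/\ (N <= 4 * n.+1 ^ 4)%N, (n = 0 -> N = 0)%N &
    (eavg_n P Lstd N d <= (2 * c)%:E)%E].
Proof.
move=> c0 /ereal_inf_lt[_ [L [phi [[HL mphi _] ->]]] hlt].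
pose F := g_sigma_algebraType (@open (Fsp P d)).
have [nu [nuD nuE]] := setting_probability d HP.
have [[mD _] _ _ [[mev Lev _ _] _] _] := HP d.
have mI : measurable_fun setT (\1_(Dom P d) : d.+1.-tuple R -> R).
  exact: measurable_indic.
have mL i : measurable_fun (setT : set F) (L i : F -> R).
  by apply: continuous_borel_measurable; case: (HL i).
have mX := @measurable_ev0 _ _ d HP.
have LX (f : Fsp P d) : L2 nu (ev0 f).
  split; first exact: (measurable_indicM mD (mev f)).
  by rewrite -nuE.
(* [gnorm2] sees only the domain, so truncation keeps the error and matches [ev0]. *)
pose phi0 y x := \1_(Dom P d) x * phi y x.
have mphi0 : measurable_fun setT (fun p : n.-tuple R * d.+1.-tuple R => phi0 p.1 p.2).
  apply: measurable_funM => //.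
  exact: (measurableT_comp mI measurable_snd).
have mphix y : measurable_fun setT (phi y) by exact: (measurable_sec2 y mphi).
have hI : (\int[mu P d]_f sqint nu (fun x => ev0 f x - phi0 [tuple L i f | i < n] x)%R
    < (c ^+ 2)%:E)%E.
  have := esqrt_lt _ c0 hlt; rewrite (_ : (\int[_]_(_ in _) _)%E = 
    (\int[mu P d]_f sqint nu (fun x => ev0 f x - phi0 [tuple L i f | i < n] x)%R)%E).
    by apply; apply: integral_ge0 => f _; exact: sqint_ge0.
  apply: eq_integral => f _; rewrite nuE.
    by congr sqint; apply/funext => x; rewrite /ev0 /phi0 mulrBr.
  by apply: measurable_funB => //; exact: measurable_funTS.
have [a ma ha] := gaussian_linear_optimal nu mX mL mphi0 (ev0_gaussian HP HL).
have c20 : 0 < c ^+ 2 by rewrite exprn_gt0.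
have [N [xs [b [[NN N0] Dxs mb hb]]]] :=
  finite_rank_sampling mX LX mL ma mD nuD c20 (le_lt_trans ha hI).
exists N; split => //.
pose L' (i : 'I_N) (f : Fsp P d) := ev P d f (xs i).
pose phi' (y : N.-tuple R) (x : d.+1.-tuple R) := \sum_(i < N) tnth y i * b i x.
have mphi' : measurable_fun setT (fun p : N.-tuple R * d.+1.-tuple R => phi' p.1 p.2).
  apply: measurable_sum => i; apply: measurable_funM.
    exact: (measurableT_comp (measurable_tnth i) measurable_fst).
  exact: (measurableT_comp (mb i) measurable_snd).
apply: (@le_trans _ _ (eavg L' phi')).
  apply: ereal_inf_lbound; exists L', phi'; split => //; split => //.
    by move=> i; exists (xs i) => //; exact: Dxs.
  move=> N00 y x; rewrite /phi'; case: N N00 {NN N0 Dxs hb L' mphi' phi'} y => // _ y.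
  by rewrite big_ord0.
pose err (f : F) x := ev0 f x - \sum_(i < N) ev0 f (xs i) * b i x.
have m2 : measurable_fun setT (fun p : F * d.+1.-tuple R => err p.1 p.2).
  apply: measurable_funB => //; apply: measurable_sum => i; apply: measurable_funM.
    exact: (measurableT_comp (measurable_sec1 (xs i) mX) measurable_fst).
  exact: (measurableT_comp (mb i) measurable_snd).
pose errD (f : F) x := \1_(Dom P d) x * err f x.
have m2D : measurable_fun setT (fun p : F * d.+1.-tuple R => errD p.1 p.2).
  apply: measurable_funM => //.
  exact: (measurableT_comp mI measurable_snd).
have E (f : Fsp P d) x :
    \1_(Dom P d) x * (ev P d f x - phi' [tuple L' i f | i < N] x) = errD f x.
  rewrite /errD /err.
  have [Dx|nDx] := pselect (Dom P d x); last by rewrite indicE memNset// !mul0r.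
  rewrite (ev0_in f Dx); congr (_ * (_ - _)); apply: eq_bigr => i _.
  by rewrite tnth_mktuple ev0_in//; exact: Dxs.
rewrite /eavg; under eq_integral => f _.
  rewrite nuE; last first.
    apply: measurable_funB => //; apply: measurable_funTS.
    exact: (measurable_sec2 _ mphi').
  under [X in sqint _ X]eq_fun do rewrite E.
  over.
apply: esqrt_le.
- by apply: integral_ge0 => f _; exact: sqint_ge0.
- by rewrite mulr_ge0// ltW.
- rewrite exprMn (_ : 2 ^+ 2 = 4); last by ring.
  apply: le_trans hb; apply: ge0_le_integral => //.
  + by move=> f _; exact: sqint_ge0.
  + exact: (measurable_sqint_param nu m2D).
  + exact: (measurable_sqint_param nu m2).
  + move=> f _; apply: ge0_le_integral => //.
    * by move=> x _; rewrite lee_fin sqr_ge0.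
    * by apply: measurable_sqr; exact: (@measurable_sec2 _ F _ _ _ errD f m2D).
    * by apply: measurable_sqr; exact: (@measurable_sec2 _ F _ _ _ err f m2).
    * move=> x _; rewrite lee_fin /errD exprMn indicE; case: (_ \in _) => /=.
        by rewrite expr1n mul1r.
      by rewrite expr0n mul0r sqr_ge0.
Qed.

Lemma nABS_le (c : info_class) (eps : R) d n : (eavg_n P c n d <= eps%:E)%E ->
  exists2 n', nABS P c eps d = Some n' & (n' <= n)%N.
Proof.
move=> h; have hn : nABS_pred P c eps d n by apply/asboolP.
rewrite /nABS; case: pselect => [ex|[]]; last by exists n.
by exists (ex_minn ex) => //; case: ex_minnP => m _; exact.
Qed.

Lemma nABS_eavg_n (c : info_class) (eps : R) d n : nABS P c eps d = Some n ->
  (eavg_n P c n d <= eps%:E)%E.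
Proof.
rewrite /nABS; case: pselect => // ex [<-].
by case: ex_minnP => m /asboolP.
Qed.

(** Monotonicity extends to [m = 0] thanks to the convention [ln 0 = 0]. *)
Lemma ler_ln_nat m n : (m <= n)%N -> ln (m%:R : R) <= ln (n%:R : R).
Proof.
case: m => [|m] mn.
  rewrite ln0//; case: n mn => [|n] _; first by rewrite ln0.
  by rewrite ln_ge0// ler1n.
by rewrite ler_ln ?posrE ?ltr0n// ?ler_nat// (leq_trans _ mn).
Qed.

Lemma ALG_WT_std_all : ALG_WT P Lstd -> ALG_WT P Lall.
Proof.
move=> H eta eta0; have [M HM] := H eta eta0; exists M => d eps eps01 hM.
have := HM d eps eps01 hM.
case E : (nABS P Lstd eps d) => [n|//] hn.
have [n' -> n'n] := nABS_le (le_trans (eavg_n_all_le_std n d) (nABS_eavg_n E)).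
apply: le_lt_trans hn; rewrite ler_wpM2r ?ler_ln_nat// invr_ge0 addr_ge0//.
by rewrite invr_ge0; case/andP: eps01 => /ltW.
Qed.

Lemma ALG_WT_all_std : ALG_WT P Lall -> ALG_WT P Lstd.
Proof.
move=> H eta eta0.
(* [24 = 4 * 3 * 2]: the exponent 4 of the point count, the loss 3 from [eps / 3], and one half of
   [eta]. The other half pays for [ln 64], through the second bound on the threshold below. *)
have [M HM] := H (eta / 24) (divr_gt0 eta0 (ltr0Sn _ _)).
exists (Num.max M (2 * ln 64 / eta)) => d eps /andP[eps0 eps1].
rewrite gt_max => /andP[hM hln].
have ev0 : 0 < eps^-1 by rewrite invr_gt0.
pose X := eps^-1 + d.+1%:R.
have X0 : 0 < X by rewrite addr_gt0.
(* Sampling doubles the error, so level [eps / 2] is needed, and strictly; [eps / 3] supplies the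
   strictness. *)
have eps3 : 0 < eps / 3 < 1 by apply/andP; split; lra.
have X3E : (eps / 3)^-1 = 3 * eps^-1 by rewrite invfM invrK mulrC.
have X3 : X <= (eps / 3)^-1 + d.+1%:R by rewrite X3E /X lerD2r; lra.
have X3' : (eps / 3)^-1 + d.+1%:R <= 3 * X.
  by rewrite X3E /X mulrDr lerD2l; have : 0 <= d.+1%:R :> R by []; lra.
have := HM d (eps / 3) eps3 (lt_le_trans hM X3).
case E : (nABS P Lall (eps / 3) d) => [n|//] hn.
have hlt : (eavg_n P Lall n d < (eps / 2)%:E)%E.
  by apply: le_lt_trans (nABS_eavg_n E) _; rewrite lte_fin; lra.
have [N [NN N0 hN]] := eavg_n_std_le_all (divr_gt0 eps0 (ltr0Sn _ _)) hlt.
have e2 : 2 * (eps / 2) = eps by field.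
rewrite e2 in hN.
have [n' -> n'N] := nABS_le hN.
rewrite ltr_pdivrMr// -/X.
have hlnX : 2 * ln 64 < X * eta by rewrite -ltr_pdivrMr.
have ln64 : 0 <= ln (64 : R) by rewrite ln_ge0// ler1n.
apply: le_lt_trans (ler_ln_nat n'N) _.
have [n0|n0] := posnP n.
  by rewrite (N0 n0) ln0// mulr_gt0.
apply: (@le_lt_trans _ _ (ln 64 + 4 * ln (n%:R : R))).
  rewrite mulr_natl -lnXn ?ltr0n// -lnM ?posrE ?exprn_gt0 ?ltr0n// -natrX -natrM.
  apply: ler_ln_nat; apply: leq_trans NN _.
  (* For positive [n], [n + 1 <= 2 n], whence [4 (n+1)^4 <= 64 n^4]. *)
  rewrite (_ : 64 = 4 * 2 ^ 4)%N// -mulnA leq_mul2l/= -expnMn leq_exp2r//.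
  by rewrite mul2n -addnn -addn1 leq_add2l.
have : ln (n%:R : R) < eta / 24 * (3 * X).
  rewrite ltr_pdivrMr in hn; last by rewrite (lt_le_trans X0).
  by apply: lt_le_trans hn _; rewrite ler_wpM2l// divr_ge0// ltW.
lra.
Qed.

End Transfer.

Theorem theorem4p3 (R : realType) (P : app_data R) :
  app_setting P -> (ALG_WT P Lall <-> ALG_WT P Lstd).
Proof. by move=> HP; split; [exact: ALG_WT_all_std|exact: ALG_WT_std_all]. Qed.
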